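(* Let $f, g:\mathbb{D}\to\mathbb{C}$ be analytic functions on the open unit disc $\mathbb{D}$, and let $L_1, L_2$ be two line segments in $\mathbb{D}$ intersecting at an angle $\theta\in(0,\pi/2)\setminus\pi\mathbb{Q}$, such that $|f(z)|=|g(z)|$ for all $z\in L_1\cup L_2$. Then $f=\beta g$ for some constant $\beta\in\mathbb{T}$.
   Context: $\mathbb{D}=\{z\in\mathbb{C}:|z|<1\}$ and $\mathbb{T}=\{z\in\mathbb{C}:|z|=1\}$. $\pi\mathbb{Q}$ denotes the set of rational multiples of $\pi$. *)

(* Defs.v *)
From Stdlib Require Import Reals.
From Coquelicot Require Export Coquelicot.
Open Scope R_scope.

Definition in_disc (z : C) : Prop := Cmod z < 1.

Definition analytic_on_disc (f : C -> C) : Prop :=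
  forall z : C, in_disc z -> @ex_derive C_AbsRing C_NormedModule f z.

Definition segment (a b : C) (z : C) : Prop :=
  exists t : R, 0 <= t <= 1 /\ z = Cplus a (Cmult (RtoC t) (Cminus b a)).

Definition disc_segment (a b : C) : Prop := a <> b /\ in_disc a /\ in_disc b.

(* The (unoriented) angle in [0, pi/2] between the lines spanned by the segments [a1,b1], [a2,b2]. *)
Definition seg_angle (a1 b1 a2 b2 : C) : R :=
  acos (Rabs (Re (Cmult (Cminus b1 a1) (Cconj (Cminus b2 a2))))
        / (Cmod (Cminus b1 a1) * Cmod (Cminus b2 a2))).

Definition segments_intersect_at_angle (a1 b1 a2 b2 : C) (theta : R) : Prop :=
  (exists z : C, segment a1 b1 z /\ segment a2 b2 z) /\ theta = seg_angle a1 b1 a2 b2.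

Definition in_pi_Q (theta : R) : Prop := exists p q : Z, q <> 0%Z /\ theta = PI * (IZR p / IZR q).

(* Main.v *)
(* At the intersection point z write f(z+w) = A w^p + ..., g(z+w) = B w^q + ... . Comparing |f|^2 and |g|^2
   along a ray gives p = q and |A| = |B|; replacing g by (A/B) g, the difference d = f - g is either identically
   zero or d(z+w) = D w^(p+n) + ... with n > 0. In the latter case 0 = |f|^2 - |f-d|^2 = 2 Re(f conj d) - |d|^2
   along both segments forces Re(A conj(D) conj(u)^n) = 0 for both directions u, hence (u1 conj(u2))^n is real
   and the angle is a rational multiple of pi.

   The leading terms come from Cauchy's formula. In the coordinate w = log(zeta) circles around 0 become
   vertical segments of length 2 pi, and Goursat's theorem on rectangles, whose horizontal sides cancel by
   periodicity, shows that circle integrals do not depend on the radius. *)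

Require Import Defs.
From Stdlib Require Import Reals Lra Lia Psatz Classical Wf_nat.
From Coquelicot Require Import Coquelicot.
Open Scope R_scope.

(** * Continuity and differentiability on C *)

(** Analyticity is given as bare complex differentiability, with no continuity of the derivative, so
    Goursat's bisection has to come before any integral formula. At that stage the difference
    quotient of [f] at [z] is only known to be continuous at [z] itself, and assuming
    differentiability there would be circular. Independence of the radius is therefore proved with
    one exceptional radius allowed. No power series is summed: the Cauchy kernel is expanded to
    finitely many terms with an estimated remainder, which yields either vanishing near the point or
    a leading term with an error of the next order. Moduli are compared on a single ray inside each
    segment, because the intersection point may be an endpoint. Along a ray the parameter is real,
    so conjugates have leading terms too. Vanishing near the intersection point is carried to the
    whole disc by a chain of overlapping discs. *)

Notation ccont := (@continuous _ C_UniformSpace).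

Lemma ccont_pair (U : UniformSpace) (u v : U -> R) (x : U) :
  continuous u x -> continuous v x -> ccont (fun t => (u t, v t) : C) x.
Proof.
  intros Hu Hv P [e He].
  assert (H1 : locally x (fun t => ball (u x) e (u t))) by exact (Hu _ (locally_ball (u x) e)).
  assert (H2 : locally x (fun t => ball (v x) e (v t))) by exact (Hv _ (locally_ball (v x) e)).
  change (locally x (fun t => P (u t, v t))).
  generalize (filter_and _ _ H1 H2).
  apply filter_imp. intros t [A B]. apply He. split; assumption.
Qed.

Lemma ccont_fst (U : UniformSpace) (f : U -> C) (x : U) :
  ccont f x -> continuous (fun t => fst (f t)) x.
Proof.
  intros H. apply (continuous_comp f fst); [exact H|].
  destruct (f x) as [a b]. apply (@continuous_fst R_UniformSpace R_UniformSpace a b).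
Qed.

Lemma ccont_snd (U : UniformSpace) (f : U -> C) (x : U) :
  ccont f x -> continuous (fun t => snd (f t)) x.
Proof.
  intros H. apply (continuous_comp f snd); [exact H|].
  destruct (f x) as [a b]. apply (@continuous_snd R_UniformSpace R_UniformSpace a b).
Qed.

Lemma ccont_const (U : UniformSpace) (c : C) (x : U) : ccont (fun _ => c) x.
Proof. apply (@continuous_const U C_UniformSpace). Qed.

Lemma ccont_id (z : C_UniformSpace) : ccont (fun w => w) z.
Proof. apply (@continuous_id C_UniformSpace). Qed.

Lemma ccont_plus (U : UniformSpace) (f g : U -> C) (x : U) :
  ccont f x -> ccont g x -> ccont (fun t => Cplus (f t) (g t)) x.
Proof.
  intros Hf Hg.
  apply ccont_pair; apply (continuous_plus (V := R_NormedModule));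
    first [apply ccont_fst | apply ccont_snd]; assumption.
Qed.

Lemma ccont_opp (U : UniformSpace) (f : U -> C) (x : U) :
  ccont f x -> ccont (fun t => Copp (f t)) x.
Proof.
  intros Hf.
  apply ccont_pair; apply (continuous_opp (V := R_NormedModule));
    first [apply ccont_fst | apply ccont_snd]; assumption.
Qed.

Lemma ccont_minus (U : UniformSpace) (f g : U -> C) (x : U) :
  ccont f x -> ccont g x -> ccont (fun t => Cminus (f t) (g t)) x.
Proof. intros Hf Hg. apply ccont_plus; [|apply ccont_opp]; assumption. Qed.

Lemma ccont_mult (U : UniformSpace) (f g : U -> C) (x : U) :
  ccont f x -> ccont g x -> ccont (fun t => Cmult (f t) (g t)) x.
Proof.
  intros Hf Hg.
  pose proof (ccont_fst _ _ _ Hf). pose proof (ccont_snd _ _ _ Hf).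
  pose proof (ccont_fst _ _ _ Hg). pose proof (ccont_snd _ _ _ Hg).
  apply ccont_pair;
    [apply (continuous_minus (V := R_NormedModule)) | apply (continuous_plus (V := R_NormedModule))];
    apply (continuous_mult (K := R_AbsRing)); assumption.
Qed.

Lemma ccont_comp (U : UniformSpace) (f : C -> C) (g : U -> C) (x : U) :
  ccont g x -> @continuous C_UniformSpace C_UniformSpace f (g x) ->
  ccont (fun t => f (g t)) x.
Proof. apply (continuous_comp g f). Qed.

Lemma ccont_inv (U : UniformSpace) (f : U -> C) (x : U) :
  ccont f x -> f x <> 0 -> ccont (fun t => Cinv (f t)) x.
Proof.
  intros Hf Hn.
  pose proof (ccont_fst _ _ _ Hf) as H1. pose proof (ccont_snd _ _ _ Hf) as H2.
  (* The squares are written [a * (a * 1)], the form to which the powers inside [Cinv] compute. *)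
  assert (Hq : fst (f x) * (fst (f x) * 1) + snd (f x) * (snd (f x) * 1) <> 0).
  { intro E. apply Hn. destruct (f x) as [a b]; cbn [fst snd] in E.
    assert (a = 0) by nra. assert (b = 0) by nra. subst; reflexivity. }
  assert (Hd : continuous (fun t => / (fst (f t) * (fst (f t) * 1) + snd (f t) * (snd (f t) * 1))) x).
  { apply (continuous_comp
      (fun t => fst (f t) * (fst (f t) * 1) + snd (f t) * (snd (f t) * 1)) Rinv).
    - apply (continuous_plus (V := R_NormedModule)); repeat apply (continuous_mult (K := R_AbsRing));
        try assumption; apply continuous_const.
    - apply (continuous_Rinv_comp (fun y => y)); [apply continuous_id|exact Hq]. }
  apply ccont_pair; apply (continuous_mult (K := R_AbsRing)); try exact Hd; try exact H1.
  apply (continuous_opp (V := R_NormedModule)); exact H2.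
Qed.

Definition nearC (z : C) (P : C -> Prop) : Prop := @locally C_UniformSpace z P.

(** The balls of [C_UniformSpace] are squares; [locally_C] allows the passage to discs of the
    modulus. *)
Lemma Cmod_locally (z : C) (P : C -> Prop) :
  nearC z P <-> exists d, 0 < d /\ forall w, Cmod (Cminus w z) < d -> P w.
Proof.
  split.
  - intros H. apply (locally_C z P) in H. destruct H as [d Hd].
    exists d. split; [apply cond_pos|]. intros w Hw. apply Hd. exact Hw.
  - intros [d [Hd H]]. apply (locally_C z P). exists (mkposreal d Hd).
    intros w Hw. apply H. exact Hw.
Qed.

Lemma ccont_iff (f : C -> C) (z : C) :
  ccont f z <-> forall e, 0 < e -> exists d, 0 < d /\
    forall w, Cmod (Cminus w z) < d -> Cmod (Cminus (f w) (f z)) < e.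
Proof.
  split.
  - intros H e He.
    assert (L : locally (f z : C_UniformSpace) (fun y => Cmod (Cminus y (f z)) < e)).
    { apply Cmod_locally. exists e. split; [exact He|]. intros w Hw; exact Hw. }
    apply H in L. apply (Cmod_locally z) in L. exact L.
  - intros H P L. apply (Cmod_locally (f z)) in L. destruct L as [e [He L]].
    destruct (H e He) as [d [Hd H']].
    apply (Cmod_locally z). exists d. split; [exact Hd|]. intros w Hw. apply L, H', Hw.
Qed.

(* Carathéodory's form of complex differentiability: the slope extends continuously. *)
Definition cdiff (f : C -> C) (z : C) : Prop :=
  exists phi : C -> C, ccont phi z /\
    nearC z (fun w => f w = Cplus (f z) (Cmult (phi w) (Cminus w z))).

Lemma cdiff_ccont f z : cdiff f z -> ccont f z.
Proof.
  intros [phi [Hp HL]].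
  apply (continuous_ext_loc (U := C_UniformSpace) _ (fun w => Cplus (f z) (Cmult (phi w) (Cminus w z)))).
  - revert HL. apply filter_imp. intros w ->. reflexivity.
  - apply ccont_plus; [apply ccont_const|]. apply ccont_mult; [exact Hp|].
    apply ccont_minus; [apply ccont_id|apply ccont_const].
Qed.

Lemma cdiff_ext_loc f g z :
  nearC z (fun w => f w = g w) -> cdiff f z -> cdiff g z.
Proof.
  intros H [phi [Hp HL]]. exists phi. split; [exact Hp|].
  assert (E : f z = g z) by apply (locally_singleton (T := C_UniformSpace) z _ H).
  generalize (filter_and _ _ H HL). apply filter_imp. intros w [A B].
  rewrite <- A, <- E. exact B.
Qed.

Lemma cdiff_const c z : cdiff (fun _ => c) z.
Proof.
  exists (fun _ => RtoC 0). split; [apply ccont_const|].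
  apply (filter_forall (T := C)). intros w. ring.
Qed.

Lemma cdiff_id z : cdiff (fun w => w) z.
Proof.
  exists (fun _ => RtoC 1). split; [apply ccont_const|].
  apply (filter_forall (T := C)). intros w. ring.
Qed.

Lemma cdiff_plus f g z : cdiff f z -> cdiff g z -> cdiff (fun w => Cplus (f w) (g w)) z.
Proof.
  intros [p [Hp Lp]] [q [Hq Lq]]. exists (fun w => Cplus (p w) (q w)).
  split; [apply ccont_plus; assumption|].
  generalize (filter_and _ _ Lp Lq). apply filter_imp. intros w [A B].
  rewrite A, B. ring.
Qed.

Lemma cdiff_mult f g z : cdiff f z -> cdiff g z -> cdiff (fun w => Cmult (f w) (g w)) z.
Proof.
  intros Hf Hg. pose proof (cdiff_ccont _ _ Hg) as Cg.
  destruct Hf as [p [Hp Lp]]. destruct Hg as [q [Hq Lq]].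
  exists (fun w => Cplus (Cmult (p w) (g w)) (Cmult (f z) (q w))).
  split.
  - apply ccont_plus; apply ccont_mult; try assumption; apply ccont_const.
  - generalize (filter_and _ _ Lp Lq). apply filter_imp. intros w [A B].
    rewrite A. rewrite B at 1 2. ring.
Qed.

Lemma cdiff_minus f g z : cdiff f z -> cdiff g z -> cdiff (fun w => Cminus (f w) (g w)) z.
Proof.
  intros Hf Hg.
  apply (cdiff_ext_loc (fun w => Cplus (f w) (Cmult (Copp 1) (g w)))).
  - apply (filter_forall (T := C)). intros w. ring.
  - apply cdiff_plus; [exact Hf|]. apply cdiff_mult; [apply cdiff_const|exact Hg].
Qed.

Lemma cdiff_inv f z : cdiff f z -> f z <> 0 -> cdiff (fun w => Cinv (f w)) z.
Proof.
  intros Hf Hn. pose proof (cdiff_ccont _ _ Hf) as Cf.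
  destruct Hf as [p [Hp Lp]].
  exists (fun w => Copp (Cmult (p w) (Cmult (Cinv (f w)) (Cinv (f z))))).
  split.
  - apply ccont_opp, ccont_mult; [exact Hp|]. apply ccont_mult; [|apply ccont_const].
    apply ccont_inv; assumption.
  - assert (Ln : nearC z (fun w => f w <> 0)).
    { apply Cmod_locally. apply (ccont_iff f z) with (e := Cmod (f z)) in Cf;
        [|apply Cmod_gt_0; exact Hn].
      destruct Cf as [d [Hd H]]. exists d. split; [exact Hd|]. intros w Hw E.
      specialize (H w Hw). rewrite E in H.
      replace (Cminus 0 (f z)) with (Copp (f z)) in H by ring. rewrite Cmod_opp in H. lra. }
    generalize (filter_and _ _ Lp Ln). apply filter_imp. intros w [A B].
    assert (E : Cmult (p w) (Cminus w z) = Cminus (f w) (f z)) by (rewrite A; ring).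
    replace (Cmult (Copp (Cmult (p w) (Cmult (Cinv (f w)) (Cinv (f z))))) (Cminus w z))
      with (Copp (Cmult (Cmult (p w) (Cminus w z)) (Cmult (Cinv (f w)) (Cinv (f z))))) by ring.
    rewrite E. field. split; assumption.
Qed.

Lemma cdiff_comp f g z : cdiff g z -> cdiff f (g z) -> cdiff (fun w => f (g w)) z.
Proof.
  intros Hg Hf. pose proof (cdiff_ccont _ _ Hg) as Cg.
  destruct Hg as [q [Hq Lq]]. destruct Hf as [p [Hp Lp]].
  exists (fun w => Cmult (p (g w)) (q w)). split.
  - apply ccont_mult; [|exact Hq]. apply ccont_comp; assumption.
  - assert (Lp' : nearC z (fun w => f (g w) =
      Cplus (f (g z)) (Cmult (p (g w)) (Cminus (g w) (g z))))) by exact (Cg _ Lp).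
    generalize (filter_and _ _ Lp' Lq). apply filter_imp. intros w [A B].
    rewrite A. rewrite B at 2. ring.
Qed.

Lemma cdiff_of_approx f z l :
  (forall e, 0 < e -> exists d, 0 < d /\ forall w, Cmod (Cminus w z) < d ->
     Cmod (Cminus (Cminus (f w) (f z)) (Cmult l (Cminus w z))) <= e * Cmod (Cminus w z)) ->
  cdiff f z.
Proof.
  intros H.
  (* The quotient is undefined at [w = z]; the value [l] there is the one that continuity forces. *)
  exists (fun w => if Ceq_dec w z then l else Cdiv (Cminus (f w) (f z)) (Cminus w z)). split.
  - apply ccont_iff. intros e He. destruct (H (e / 2)) as [d [Hd Hw]]; [lra|].
    exists d. split; [exact Hd|]. intros w Hwd.
    destruct (Ceq_dec z z) as [_|N]; [|now elim N].
    destruct (Ceq_dec w z) as [E|N].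
    + replace (Cminus l l) with (RtoC 0) by ring. rewrite Cmod_0. exact He.
    + assert (N' := Cminus_eq_contra _ _ N). specialize (Hw w Hwd).
      assert (0 < Cmod (Cminus w z)) by (apply Cmod_gt_0; exact N').
      replace (Cminus (f w) (f z)) with
        (Cmult (Cdiv (Cminus (f w) (f z)) (Cminus w z)) (Cminus w z)) in Hw
        by (field; exact N').
      replace (Cminus (Cmult (Cdiv (Cminus (f w) (f z)) (Cminus w z)) (Cminus w z))
                 (Cmult l (Cminus w z)))
        with (Cmult (Cminus (Cdiv (Cminus (f w) (f z)) (Cminus w z)) l) (Cminus w z)) in Hw by ring.
      rewrite Cmod_mult in Hw. apply Rmult_le_reg_r in Hw; [lra|assumption].
  - apply (filter_forall (T := C)). intros w. destruct (Ceq_dec w z) as [->|N]; [ring|].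
    field. apply Cminus_eq_contra; exact N.
Qed.

Lemma cdiff_approx f z : cdiff f z -> exists l,
  forall e, 0 < e -> exists d, 0 < d /\ forall w, Cmod (Cminus w z) < d ->
     Cmod (Cminus (f w) (Cplus (f z) (Cmult l (Cminus w z)))) <= e * Cmod (Cminus w z).
Proof.
  intros [phi [Hp HL]]. exists (phi z). intros e He.
  apply (Cmod_locally z) in HL. destruct HL as [d1 [Hd1 H1]].
  apply (ccont_iff phi z) with (e := e) in Hp; [|exact He]. destruct Hp as [d2 [Hd2 H2]].
  exists (Rmin d1 d2). split; [apply Rmin_pos; assumption|]. intros w Hw.
  rewrite (H1 w) by (eapply Rlt_le_trans; [exact Hw|apply Rmin_l]).
  specialize (H2 w (Rlt_le_trans _ _ _ Hw (Rmin_r _ _))).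
  replace (Cminus (Cplus (f z) (Cmult (phi w) (Cminus w z))) (Cplus (f z) (Cmult (phi z) (Cminus w z))))
    with (Cmult (Cminus (phi w) (phi z)) (Cminus w z)) by ring.
  rewrite Cmod_mult. apply Rmult_le_compat_r; [apply Cmod_ge_0|lra].
Qed.

Lemma cdiff_of_ex_derive (f : C -> C) (z : C) :
  @ex_derive C_AbsRing C_NormedModule f z -> cdiff f z.
Proof.
  intros [l [_ H]]. apply cdiff_of_approx with (l := l). intros e He.
  specialize (H z (fun P HP => HP) (mkposreal e He)).
  apply (locally_C z) in H. apply (Cmod_locally z) in H.
  destruct H as [d [Hd H]]. exists d. split; [exact Hd|]. intros w Hw. specialize (H w Hw).
  rewrite (Cmult_comm l). exact H.
Qed.

(** * Goursat's theorem on rectangles *)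

Definition ccont_on (f : R -> C) (a b : R) : Prop := forall t, a <= t <= b -> ccont f t.

(** Taken coordinatewise, so that the theory of real integrals applies to each part. *)
Definition Cint (f : R -> C) (a b : R) : C :=
  (RInt (fun t => fst (f t)) a b, RInt (fun t => snd (f t)) a b).

Lemma ex_RInt_fst f a b : a <= b -> ccont_on f a b -> ex_RInt (fun t => fst (f t)) a b.
Proof.
  intros Hab H. apply (ex_RInt_continuous (V := R_CompleteNormedModule)). intros t Ht.
  rewrite Rmin_left, Rmax_right in Ht by exact Hab. apply ccont_fst, H, Ht.
Qed.

Lemma ex_RInt_snd f a b : a <= b -> ccont_on f a b -> ex_RInt (fun t => snd (f t)) a b.
Proof.
  intros Hab H. apply (ex_RInt_continuous (V := R_CompleteNormedModule)). intros t Ht.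
  rewrite Rmin_left, Rmax_right in Ht by exact Hab. apply ccont_snd, H, Ht.
Qed.

Lemma Cint_ext f g a b : a <= b -> (forall t, a <= t <= b -> f t = g t) -> Cint f a b = Cint g a b.
Proof.
  intros Hab H. unfold Cint. apply (f_equal2 pair); apply RInt_ext; intros t Ht;
    rewrite Rmin_left, Rmax_right in Ht by exact Hab; rewrite H; [reflexivity|lra|reflexivity|lra].
Qed.

Lemma Cint_Chasles f a b c : a <= b <= c -> ccont_on f a c ->
  Cplus (Cint f a b) (Cint f b c) = Cint f a c.
Proof.
  intros Hb H. unfold Cint, Cplus; cbn [fst snd].
  assert (H1 : ccont_on f a b) by (intros t Ht; apply H; lra).
  assert (H2 : ccont_on f b c) by (intros t Ht; apply H; lra).
  apply (f_equal2 pair);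
    [apply (RInt_Chasles (V := R_CompleteNormedModule)); apply ex_RInt_fst
    |apply (RInt_Chasles (V := R_CompleteNormedModule)); apply ex_RInt_snd]; first [assumption | lra].
Qed.

Lemma Cint_plus f g a b : a <= b -> ccont_on f a b -> ccont_on g a b ->
  Cint (fun t => Cplus (f t) (g t)) a b = Cplus (Cint f a b) (Cint g a b).
Proof.
  intros Hab Hf Hg. unfold Cint, Cplus; cbn [fst snd].
  apply (f_equal2 pair);
    [apply (RInt_plus (V := R_CompleteNormedModule)); apply ex_RInt_fst
    |apply (RInt_plus (V := R_CompleteNormedModule)); apply ex_RInt_snd]; assumption.
Qed.

Lemma Cint_scal k f a b : a <= b -> ccont_on f a b ->
  Cint (fun t => Cmult k (f t)) a b = Cmult k (Cint f a b).
Proof.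
  intros Hab Hf. destruct k as [p q].
  pose proof (ex_RInt_fst _ _ _ Hab Hf) as H1. pose proof (ex_RInt_snd _ _ _ Hab Hf) as H2.
  unfold Cint, Cmult; cbn [fst snd].
  assert (K1 : forall r, RInt (fun t => r * fst (f t)) a b = r * RInt (fun t => fst (f t)) a b)
    by (intros r; exact (RInt_scal (V := R_CompleteNormedModule) (fun t => fst (f t)) a b r H1)).
  assert (K2 : forall r, RInt (fun t => r * snd (f t)) a b = r * RInt (fun t => snd (f t)) a b)
    by (intros r; exact (RInt_scal (V := R_CompleteNormedModule) (fun t => snd (f t)) a b r H2)).
  assert (S1 : forall r, ex_RInt (fun t => r * fst (f t)) a b)
    by (intros r; exact (ex_RInt_scal (V := R_NormedModule) (fun t => fst (f t)) a b r H1)).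
  assert (S2 : forall r, ex_RInt (fun t => r * snd (f t)) a b)
    by (intros r; exact (ex_RInt_scal (V := R_NormedModule) (fun t => snd (f t)) a b r H2)).
  apply (f_equal2 pair); rewrite <- !K1, <- !K2.
  - exact (RInt_minus (V := R_CompleteNormedModule) _ _ a b (S1 p) (S2 q)).
  - exact (RInt_plus (V := R_CompleteNormedModule) _ _ a b (S2 p) (S1 q)).
Qed.

Lemma Cint_opp f a b : a <= b -> ccont_on f a b ->
  Cint (fun t => Copp (f t)) a b = Copp (Cint f a b).
Proof.
  intros Hab Hf. transitivity (Cint (fun t => Cmult (Copp 1) (f t)) a b).
  - apply Cint_ext; [exact Hab|]. intros; ring.
  - rewrite Cint_scal by assumption. ring.
Qed.

Lemma Cint_minus f g a b : a <= b -> ccont_on f a b -> ccont_on g a b ->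
  Cint (fun t => Cminus (f t) (g t)) a b = Cminus (Cint f a b) (Cint g a b).
Proof.
  intros Hab Hf Hg. unfold Cminus. rewrite Cint_plus; try assumption.
  - rewrite Cint_opp by assumption. reflexivity.
  - intros t Ht. apply ccont_opp, Hg, Ht.
Qed.

Lemma Cint_affine P Q a b : a <= b ->
  Cint (fun t => Cplus P (Cmult (RtoC t) Q)) a b =
  Cplus (Cmult (RtoC (b - a)) P) (Cmult (RtoC ((b * b - a * a) / 2)) Q).
Proof.
  intros Hab.
  assert (K : forall p q : R, RInt (fun t => p + t * q) a b = (b - a) * p + (b * b - a * a) / 2 * q).
  { intros p q. apply is_RInt_unique.
    replace ((b - a) * p + (b * b - a * a) / 2 * q)
      with (minus ((fun t => t * p + t * t / 2 * q) b) ((fun t => t * p + t * t / 2 * q) a))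
      by (unfold minus, plus, opp; simpl; field).
    apply (is_RInt_derive (V := R_CompleteNormedModule) (fun t => t * p + t * t / 2 * q)).
    - intros t _. auto_derive; [trivial|]. field.
    - intros t _. apply (continuous_plus (V := R_NormedModule)); [apply continuous_const|].
      apply (continuous_mult (K := R_AbsRing)); [apply continuous_id|apply continuous_const]. }
  destruct P as [p1 p2], Q as [q1 q2]. unfold Cint, Cplus, Cmult, RtoC; cbn [fst snd].
  apply (f_equal2 pair);
    [rewrite (RInt_ext _ (fun t => p1 + t * q1)) by (intros; simpl; ring)
    |rewrite (RInt_ext _ (fun t => p2 + t * q2)) by (intros; simpl; ring)]; rewrite K; field.
Qed.

Lemma Cint_const c a b : a <= b -> Cint (fun _ => c) a b = Cmult (RtoC (b - a)) c.
Proof.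
  intros Hab. rewrite <- (Cint_ext (fun t => Cplus c (Cmult (RtoC t) 0))) by (intros; try ring; exact Hab).
  rewrite Cint_affine by exact Hab. ring.
Qed.

Lemma Cmod_le_abs (z : C) : Cmod z <= Rabs (fst z) + Rabs (snd z).
Proof.
  destruct z as [x y]; cbn [fst snd].
  replace ((x, y) : C) with (Cplus (RtoC x) (Cmult Ci (RtoC y)))
    by (unfold Cplus, Cmult, Ci, RtoC; cbn [fst snd]; apply (f_equal2 pair); ring).
  eapply Rle_trans; [apply Cmod_triangle|]. rewrite Cmod_mult, !Cmod_R.
  replace (Cmod Ci) with 1; [lra|]. unfold Cmod, Ci; cbn [fst snd].
  replace (0 ^ 2 + 1 ^ 2) with 1 by ring. symmetry; apply sqrt_1.
Qed.

(* The factor 2 comes from integrating real and imaginary parts separately. *)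
Lemma Cint_bound f a b M : a <= b -> ccont_on f a b ->
  (forall t, a <= t <= b -> Cmod (f t) <= M) -> Cmod (Cint f a b) <= 2 * (M * (b - a)).
Proof.
  intros Hab Hf HM. eapply Rle_trans; [apply Cmod_le_abs|]. unfold Cint; cbn [fst snd].
  assert (H1 : Rabs (RInt (fun t => fst (f t)) a b) <= (b - a) * M).
  { apply abs_RInt_le_const; [exact Hab|apply ex_RInt_fst; assumption|].
    intros t Ht. eapply Rle_trans; [apply re_le_Cmod|]. apply HM, Ht. }
  assert (H2 : Rabs (RInt (fun t => snd (f t)) a b) <= (b - a) * M).
  { apply abs_RInt_le_const; [exact Hab|apply ex_RInt_snd; assumption|].
    intros t Ht. eapply Rle_trans; [|apply HM, Ht].
    eapply Rle_trans; [|apply Rmax_Cmod]. apply Rmax_r. }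
  lra.
Qed.

(** The common point is the supremum of the left endpoints. Comparing [a m] and [b n] through the
    interval of index [m + n] shows that every right endpoint bounds all left ones. *)
Lemma nested_intervals (a b : nat -> R) :
  (forall n, a n <= a (S n) /\ a (S n) <= b (S n) /\ b (S n) <= b n) ->
  a O <= b O -> exists x, forall n, a n <= x <= b n.
Proof.
  intros H H0.
  assert (Ha : forall n k, a n <= a (n + k)%nat).
  { intros n k. induction k as [|k IH]; [rewrite Nat.add_0_r; lra|].
    rewrite Nat.add_succ_r. destruct (H (n + k)%nat). lra. }
  assert (Hb : forall n k, b (n + k)%nat <= b n).
  { intros n k. induction k as [|k IH]; [rewrite Nat.add_0_r; lra|].
    rewrite Nat.add_succ_r. destruct (H (n + k)%nat) as [? [? ?]]. lra. }
  assert (Hab : forall n, a n <= b n) by (intros [|n]; [exact H0|apply H]).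
  assert (K : forall m n, a m <= b n).
  { intros m n. generalize (Ha m n) (Hb n m) (Hab (m + n)%nat).
    rewrite (Nat.add_comm n m). lra. }
  destruct (completeness (fun y => exists n, y = a n)) as [x [Hu Hl]].
  - exists (b O). intros y [n ->]. apply K.
  - exists (a O), O. reflexivity.
  - exists x. intros n. split; [apply Hu; exists n; reflexivity|].
    apply Hl. intros y [m ->]. apply K.
Qed.

(** Compactness in the form used by Goursat: were [P] false for the large rectangle, it would be
    false for one of its quarters, and so on; the nested rectangles shrink to a point, near which
    the local hypothesis makes [P] true. Decidability in [sumbool] form lets a function select the
    failing quarter. *)
Lemma rect_bisection (P : R -> R -> R -> R -> Prop) (x1 x2 y1 y2 : R) :
  (forall a b c d, {P a b c d} + {~ P a b c d}) ->
  x1 <= x2 -> y1 <= y2 ->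
  (forall a b c d, x1 <= a -> a <= b -> b <= x2 -> y1 <= c -> c <= d -> d <= y2 ->
    P a ((a + b) / 2) c ((c + d) / 2) -> P ((a + b) / 2) b c ((c + d) / 2) ->
    P a ((a + b) / 2) ((c + d) / 2) d -> P ((a + b) / 2) b ((c + d) / 2) d -> P a b c d) ->
  (forall x y, x1 <= x <= x2 -> y1 <= y <= y2 -> exists e, 0 < e /\
    forall a b c d, x1 <= a <= x -> x <= b <= x2 -> y1 <= c <= y -> y <= d <= y2 ->
      b - a < e -> d - c < e -> P a b c d) ->
  P x1 x2 y1 y2.
Proof.
  intros dec Hx Hy Hsub Hloc. destruct (dec x1 x2 y1 y2) as [HP|HN]; [exact HP|exfalso].
  (* Three quarters are tested and the fourth is the default: if [P] holds on the first three,
     [Hsub] forces it to fail on the last. *)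
  set (step := fun q : (R * R) * (R * R) =>
    let '((a, b), (c, d)) := q in let m := (a + b) / 2 in let n := (c + d) / 2 in
    if dec a m c n then if dec m b c n then if dec a m n d
      then ((m, b), (n, d)) else ((a, m), (n, d)) else ((m, b), (c, n)) else ((a, m), (c, n))).
  set (q := fix q n := match n with O => ((x1, x2), (y1, y2)) | S n => step (q n) end).
  set (a := fun n => fst (fst (q n))). set (b := fun n => snd (fst (q n))).
  set (c := fun n => fst (snd (q n))). set (d := fun n => snd (snd (q n))).
  set (good := fun q0 : (R * R) * (R * R) => let '((a, b), (c, d)) := q0 in
    x1 <= a /\ a <= b /\ b <= x2 /\ y1 <= c /\ c <= d /\ d <= y2 /\ ~ P a b c d).
  set (shrink := fun q0 q1 : (R * R) * (R * R) =>
    (fst (fst q0) <= fst (fst q1) /\ fst (fst q1) <= snd (fst q1) /\ snd (fst q1) <= snd (fst q0)) /\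
    (fst (snd q0) <= fst (snd q1) /\ fst (snd q1) <= snd (snd q1) /\ snd (snd q1) <= snd (snd q0)) /\
    snd (fst q1) - fst (fst q1) = (snd (fst q0) - fst (fst q0)) / 2 /\
    snd (snd q1) - fst (snd q1) = (snd (snd q0) - fst (snd q0)) / 2).
  assert (Hstep : forall q0, good q0 -> good (step q0) /\ shrink q0 (step q0)).
  { intros [[a0 b0] [c0 d0]] (A1 & A2 & A3 & A4 & A5 & A6 & NP). unfold step, good, shrink.
    destruct (dec a0 ((a0 + b0) / 2) c0 ((c0 + d0) / 2)) as [P1|P1];
    [destruct (dec ((a0 + b0) / 2) b0 c0 ((c0 + d0) / 2)) as [P2|P2];
    [destruct (dec a0 ((a0 + b0) / 2) ((c0 + d0) / 2) d0) as [P3|P3]|]|]; cbn [fst snd];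
    repeat split; try lra; try assumption.
    intro P4. apply NP. apply Hsub; assumption. }
  assert (Hgood : forall n, good (q n)).
  { intros n. induction n as [|n IH]; [simpl; repeat split; try lra; assumption|].
    apply Hstep, IH. }
  assert (Hsh : forall n, shrink (q n) (q (S n))) by (intros n; apply (Hstep _ (Hgood n))).
  destruct (nested_intervals a b) as [x Hxn]; [intros n; apply (Hsh n)|exact Hx|].
  destruct (nested_intervals c d) as [y Hyn]; [intros n; apply (Hsh n)|exact Hy|].
  assert (Wx : forall n, b n - a n = (x2 - x1) * (1 / 2) ^ n).
  { intros n. induction n as [|n IH]; [unfold a, b; simpl; ring|].
    destruct (Hsh n) as [_ [_ [E _]]]. unfold a, b in *. rewrite E, IH. simpl; field. }
  assert (Wy : forall n, d n - c n = (y2 - y1) * (1 / 2) ^ n).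
  { intros n. induction n as [|n IH]; [unfold c, d; simpl; ring|].
    destruct (Hsh n) as [_ [_ [_ E]]]. unfold c, d in *. rewrite E, IH. simpl; field. }
  destruct (Hloc x y (Hxn O) (Hyn O)) as [e [He HeP]].
  (* [W] dominates both side lengths, and the added 1 keeps it positive for a degenerate
     rectangle. *)
  set (W := (x2 - x1) + (y2 - y1) + 1).
  assert (HW : 0 < W) by (unfold W; lra).
  destruct (pow_lt_1_zero (1 / 2)) with (y := e / W) as [N HN'].
  { rewrite Rabs_pos_eq; lra. }
  { apply Rdiv_lt_0_compat; assumption. }
  specialize (HN' N (le_n N)). assert (Hp : 0 < (1 / 2) ^ N) by (apply pow_lt; lra).
  rewrite Rabs_pos_eq in HN' by lra.
  assert (HWe : W * (1 / 2) ^ N < e).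
  { apply Rmult_lt_reg_r with (/ W); [apply Rinv_0_lt_compat; exact HW|].
    replace (W * (1 / 2) ^ N * / W) with ((1 / 2) ^ N) by (field; lra). exact HN'. }
  specialize (Wx N). specialize (Wy N). specialize (Hxn N). specialize (Hyn N).
  generalize (Hgood N). unfold a, b, c, d in *. destruct (q N) as [[aN bN] [cN dN]]; cbn [fst snd] in *.
  intros (A1 & A2 & A3 & A4 & A5 & A6 & NP). apply NP, HeP; try lra; unfold W in *; nra.
Qed.

(** The counterclockwise contour integral over the boundary of [[a,b] x [c,d]]: [dz = dt] on the
    horizontal sides and [dz = i dt] on the vertical ones. *)
Definition rect_int (G : C -> C) (a b c d : R) : C :=
  Cplus (Cminus (Cint (fun t => G (t, c)) a b) (Cint (fun t => G (t, d)) a b))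
        (Cmult Ci (Cminus (Cint (fun t => G (b, t)) c d) (Cint (fun t => G (a, t)) c d))).

Definition ccont_rect (G : C -> C) (a b c d : R) : Prop :=
  forall x y, a <= x <= b -> c <= y <= d -> ccont G ((x, y) : C).

Lemma ccont_horizontal (G : C -> C) (y t : R) : ccont G ((t, y) : C) -> ccont (fun t => G (t, y)) t.
Proof.
  intros H. apply (ccont_comp _ G (fun t => (t, y) : C)); [|exact H].
  apply ccont_pair; [apply continuous_id|apply continuous_const].
Qed.

Lemma ccont_vertical (G : C -> C) (x t : R) : ccont G ((x, t) : C) -> ccont (fun t => G (x, t)) t.
Proof.
  intros H. apply (ccont_comp _ G (fun t => (x, t) : C)); [|exact H].
  apply ccont_pair; [apply continuous_const|apply continuous_id].
Qed.

Lemma ccont_on_horizontal (G : C -> C) (a b c d y : R) :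
  ccont_rect G a b c d -> c <= y <= d -> ccont_on (fun t => G (t, y)) a b.
Proof. intros H Hy t Ht. apply ccont_horizontal, H; assumption. Qed.

Lemma ccont_on_vertical (G : C -> C) (a b c d x : R) :
  ccont_rect G a b c d -> a <= x <= b -> ccont_on (fun t => G (x, t)) c d.
Proof. intros H Hx t Ht. apply ccont_vertical, H; assumption. Qed.

(** Each inner side is traversed twice in opposite directions and cancels. *)
Lemma rect_int_quarter (G : C -> C) (a b c d : R) :
  a <= b -> c <= d -> ccont_rect G a b c d ->
  rect_int G a b c d =
  Cplus (Cplus (rect_int G a ((a + b) / 2) c ((c + d) / 2)) (rect_int G ((a + b) / 2) b c ((c + d) / 2)))
        (Cplus (rect_int G a ((a + b) / 2) ((c + d) / 2) d) (rect_int G ((a + b) / 2) b ((c + d) / 2) d)).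
Proof.
  intros Hab Hcd H. unfold rect_int.
  assert (Hc : c <= c <= d) by lra. assert (Hd : c <= d <= d) by lra.
  assert (Ha : a <= a <= b) by lra. assert (Hb : a <= b <= b) by lra.
  assert (Hm : a <= (a + b) / 2 <= b) by lra. assert (Hn : c <= (c + d) / 2 <= d) by lra.
  pose proof (ccont_on_horizontal _ _ _ _ _ _ H Hc). pose proof (ccont_on_horizontal _ _ _ _ _ _ H Hd).
  pose proof (ccont_on_vertical _ _ _ _ _ _ H Ha). pose proof (ccont_on_vertical _ _ _ _ _ _ H Hb).
  rewrite <- (Cint_Chasles (fun t => G (t, c)) a ((a + b) / 2) b) by assumption.
  rewrite <- (Cint_Chasles (fun t => G (t, d)) a ((a + b) / 2) b) by assumption.
  rewrite <- (Cint_Chasles (fun t => G (a, t)) c ((c + d) / 2) d) by assumption.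
  rewrite <- (Cint_Chasles (fun t => G (b, t)) c ((c + d) / 2) d) by assumption.
  ring.
Qed.

Lemma rect_int_plus (G H : C -> C) (a b c d : R) :
  a <= b -> c <= d -> ccont_rect G a b c d -> ccont_rect H a b c d ->
  rect_int (fun w => Cplus (G w) (H w)) a b c d = Cplus (rect_int G a b c d) (rect_int H a b c d).
Proof.
  intros Hab Hcd CG CH. unfold rect_int.
  assert (Hc : c <= c <= d) by lra. assert (Hd : c <= d <= d) by lra.
  assert (Ha : a <= a <= b) by lra. assert (Hb : a <= b <= b) by lra.
  rewrite (Cint_plus (fun t => G (t, c)) (fun t => H (t, c)) a b Hab
    (ccont_on_horizontal _ _ _ _ _ _ CG Hc) (ccont_on_horizontal _ _ _ _ _ _ CH Hc)).
  rewrite (Cint_plus (fun t => G (t, d)) (fun t => H (t, d)) a b Hab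
    (ccont_on_horizontal _ _ _ _ _ _ CG Hd) (ccont_on_horizontal _ _ _ _ _ _ CH Hd)).
  rewrite (Cint_plus (fun t => G (a, t)) (fun t => H (a, t)) c d Hcd
    (ccont_on_vertical _ _ _ _ _ _ CG Ha) (ccont_on_vertical _ _ _ _ _ _ CH Ha)).
  rewrite (Cint_plus (fun t => G (b, t)) (fun t => H (b, t)) c d Hcd
    (ccont_on_vertical _ _ _ _ _ _ CG Hb) (ccont_on_vertical _ _ _ _ _ _ CH Hb)).
  ring.
Qed.

Lemma rect_int_ext (G H : C -> C) (a b c d : R) :
  a <= b -> c <= d -> (forall w, G w = H w) -> rect_int G a b c d = rect_int H a b c d.
Proof.
  intros Hab Hcd E. unfold rect_int.
  f_equal; [|f_equal]; f_equal; apply Cint_ext; intros; first [assumption | apply E].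
Qed.

(** The constant 4 is two parallel sides in each direction times the factor 2 of [Cint_bound]. *)
Lemma rect_int_bound (G : C -> C) (a b c d M : R) :
  a <= b -> c <= d -> ccont_rect G a b c d ->
  (forall x y, a <= x <= b -> c <= y <= d -> Cmod (G (x, y)) <= M) ->
  Cmod (rect_int G a b c d) <= 4 * M * (b - a + (d - c)).
Proof.
  intros Hab Hcd H HM. unfold rect_int.
  eapply Rle_trans; [apply Cmod_triangle|]. rewrite Cmod_mult.
  replace (Cmod Ci) with 1
    by (unfold Cmod, Ci; cbn [fst snd]; replace (0 ^ 2 + 1 ^ 2) with 1 by ring; symmetry; apply sqrt_1).
  assert (T : forall u v, Cmod (Cminus u v) <= Cmod u + Cmod v).
  { intros u v. unfold Cminus. eapply Rle_trans; [apply Cmod_triangle|]. rewrite Cmod_opp. lra. }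
  generalize (T (Cint (fun t => G (t, c)) a b) (Cint (fun t => G (t, d)) a b)).
  generalize (T (Cint (fun t => G (b, t)) c d) (Cint (fun t => G (a, t)) c d)).
  assert (B1 : Cmod (Cint (fun t => G (t, c)) a b) <= 2 * (M * (b - a)))
    by (apply Cint_bound; [assumption|apply (ccont_on_horizontal _ a b c d); [exact H|lra]|intros; apply HM; lra]).
  assert (B2 : Cmod (Cint (fun t => G (t, d)) a b) <= 2 * (M * (b - a)))
    by (apply Cint_bound; [assumption|apply (ccont_on_horizontal _ a b c d); [exact H|lra]|intros; apply HM; lra]).
  assert (B3 : Cmod (Cint (fun t => G (b, t)) c d) <= 2 * (M * (d - c)))
    by (apply Cint_bound; [assumption|apply (ccont_on_vertical _ a b c d); [exact H|lra]|intros; apply HM; lra]).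
  assert (B4 : Cmod (Cint (fun t => G (a, t)) c d) <= 2 * (M * (d - c)))
    by (apply Cint_bound; [assumption|apply (ccont_on_vertical _ a b c d); [exact H|lra]|intros; apply HM; lra]).
  lra.
Qed.

(** Cauchy's theorem for affine functions, by explicit integration; it removes the first-order part
    in Goursat's argument. *)
Lemma rect_int_affine (A B : C) (a b c d : R) : a <= b -> c <= d ->
  rect_int (fun w => Cplus A (Cmult B w)) a b c d = 0.
Proof.
  intros Hab Hcd. unfold rect_int.
  assert (E1 : forall y, Cint (fun t => Cplus A (Cmult B (t, y))) a b =
    Cint (fun t => Cplus (Cplus A (Cmult B (Cmult Ci (RtoC y)))) (Cmult (RtoC t) B)) a b).
  { intros y. apply Cint_ext; [exact Hab|]. intros t _.
    destruct A, B. unfold Cplus, Cmult, Ci, RtoC; cbn [fst snd]. apply (f_equal2 pair); ring. }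
  assert (E2 : forall x, Cint (fun t => Cplus A (Cmult B (x, t))) c d =
    Cint (fun t => Cplus (Cplus A (Cmult B (RtoC x))) (Cmult (RtoC t) (Cmult Ci B))) c d).
  { intros x. apply Cint_ext; [exact Hcd|]. intros t _.
    destruct A, B. unfold Cplus, Cmult, Ci, RtoC; cbn [fst snd]. apply (f_equal2 pair); ring. }
  rewrite !E1, !E2, !Cint_affine by assumption.
  destruct A, B. unfold Cminus, Copp, Cplus, Cmult, Ci, RtoC; cbn [fst snd]. apply (f_equal2 pair); field.
Qed.

(** The bound [e] times the squared half perimeter has the right scaling: each quarter has a fourth
    of it, so four quarters add up to the whole. Near a point, the affine part integrates to 0 and
    the remainder is at most [e / 4] times the half perimeter; the factor 4 of [rect_int_bound] and
    a second half perimeter complete the bound. *)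
Lemma goursat_rect (G : C -> C) (x1 x2 y1 y2 : R) : x1 <= x2 -> y1 <= y2 ->
  (forall x y, x1 <= x <= x2 -> y1 <= y <= y2 -> cdiff G (x, y)) ->
  rect_int G x1 x2 y1 y2 = 0.
Proof.
  intros Hx Hy HG. apply Cmod_eq_0.
  assert (Hc : forall a b c d, x1 <= a -> b <= x2 -> y1 <= c -> d <= y2 -> ccont_rect G a b c d)
    by (intros a b c d ? ? ? ? x y ? ?; apply cdiff_ccont, HG; lra).
  assert (K : forall e, 0 < e -> Cmod (rect_int G x1 x2 y1 y2) <= e * ((x2 - x1) + (y2 - y1)) ^ 2).
  { intros e He.
    apply (rect_bisection (fun a b c d => Cmod (rect_int G a b c d) <= e * ((b - a) + (d - c)) ^ 2));
      try assumption.
    - intros; apply Rle_dec.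
    - intros a b c d ? ? ? ? ? ? P1 P2 P3 P4. rewrite rect_int_quarter by (try assumption; apply Hc; assumption).
      eapply Rle_trans; [apply Cmod_triangle|].
      eapply Rle_trans; [apply Rplus_le_compat; apply Cmod_triangle|].
      replace (e * (b - a + (d - c)) ^ 2) with
        (4 * (e * (((a + b) / 2 - a) + ((c + d) / 2 - c)) ^ 2)) by field.
      replace (b - (a + b) / 2) with ((a + b) / 2 - a) in * by field.
      replace (d - (c + d) / 2) with ((c + d) / 2 - c) in * by field. lra.
    - intros x y Hxx Hyy. destruct (cdiff_approx _ _ (HG x y Hxx Hyy)) as [l Hl].
      destruct (Hl (e / 4)) as [dl [Hdl Hb]]; [lra|].
      (* Two sides shorter than [dl / 2] give a half perimeter below [dl], which bounds the distance
         of every point of the rectangle to [(x, y)]. *)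
      exists (dl / 2). split; [lra|]. intros a b c d Ha Hb' Hc' Hd Hab Hcd.
      set (A := Cminus (G (x, y)) (Cmult l (x, y))).
      set (r := fun w => Cminus (G w) (Cplus A (Cmult l w))).
      rewrite (rect_int_ext G (fun w => Cplus (Cplus A (Cmult l w)) (r w))) by (try lra; intros; unfold r; ring).
      assert (Caff : ccont_rect (fun w => Cplus A (Cmult l w)) a b c d).
      { intros u v _ _. apply ccont_plus; [apply ccont_const|]. apply ccont_mult; [apply ccont_const|apply ccont_id]. }
      assert (CG : ccont_rect G a b c d) by (apply Hc; lra).
      assert (Cr : ccont_rect r a b c d).
      { intros u v Hu Hv. apply ccont_minus; [apply CG|apply Caff]; assumption. }
      rewrite rect_int_plus, rect_int_affine, Cplus_0_l by first [assumption | lra].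
      eapply Rle_trans; [apply rect_int_bound with (M := e / 4 * ((b - a) + (d - c)))|];
        [lra|lra|exact Cr| |right; field].
      intros u v Hu Hv.
      assert (Hw : Cmod (Cminus (u, v) (x, y)) <= (b - a) + (d - c)).
      { eapply Rle_trans; [apply Cmod_le_abs|]. unfold Cminus, Cplus, Copp; cbn [fst snd].
        apply Rplus_le_compat; apply Rabs_le; lra. }
      replace (r (u, v)) with (Cminus (G (u, v)) (Cplus (G (x, y)) (Cmult l (Cminus (u, v) (x, y)))))
        by (unfold r, A; ring).
      eapply Rle_trans; [apply Hb; lra|]. apply Rmult_le_compat_l; lra. }
  apply Rle_antisym; [|apply Cmod_ge_0]. apply le_epsilon. intros e He.
  (* Division by [S + 1] below avoids the case [S = 0] of a rectangle reduced to a point. *)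
  set (S := ((x2 - x1) + (y2 - y1)) ^ 2). assert (HS : 0 <= S) by apply pow2_ge_0.
  eapply Rle_trans; [apply (K (e / (S + 1)))|]; fold S.
  - apply Rdiv_lt_0_compat; lra.
  - rewrite Rplus_0_l. apply Rmult_le_reg_r with (S + 1); [lra|].
    replace (e / (S + 1) * S * (S + 1)) with (e * S) by (field; lra). nra.
Qed.

(** * Cauchy's formula on circles *)

Lemma Cmod_le_eps_0 (z : C) : (forall e, 0 < e -> Cmod z <= e) -> z = 0.
Proof.
  intros H. apply Cmod_eq_0, Rle_antisym; [|apply Cmod_ge_0].
  apply le_epsilon. intros e He. specialize (H e He). lra.
Qed.

Lemma continuity_2d_pt_of_continuous (f : C -> R) (x y : R) :
  @continuous C_UniformSpace R_UniformSpace f (x, y) -> continuity_2d_pt (fun u v => f (u, v)) x y.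
Proof.
  intros H. apply continuity_2d_pt_filterlim.
  apply (filterlim_ext f); [intros [u v]; reflexivity|exact H].
Qed.

(** The factor [i] of [dz] is left out: for [G = F o cexp] this is the integral of [F] against the
    angle [dt] over the circle of radius [exp x]. *)
Definition vint (G : C -> C) (x : R) : C := Cint (fun t => G (x, t)) 0 (2 * PI).

Lemma two_PI_pos : 0 < 2 * PI.
Proof. generalize PI_RGT_0. lra. Qed.

Lemma vint_unif_cont (G : C -> C) (a b : R) : ccont_rect G a b 0 (2 * PI) ->
  forall e, 0 < e -> exists d, 0 < d /\ forall x x', a <= x <= b -> a <= x' <= b ->
    Rabs (x' - x) < d -> Cmod (Cminus (vint G x') (vint G x)) <= e.
Proof.
  intros HG e He. pose proof two_PI_pos as Hpi.
  (* Each coordinate moves by less than [e'], the modulus by at most [2 * e']; the length [2 * PI]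
     and the factor 2 of [Cint_bound] turn this into [8 * PI * e' = e]. *)
  set (e' := e / (8 * PI)). assert (He' : 0 < e') by (apply Rdiv_lt_0_compat; lra).
  destruct (uniform_continuity_2d (fun u v => fst (G (u, v))) a b 0 (2 * PI)) with (eps := mkposreal e' He')
    as [d1 H1].
  { intros x y Hx Hy. apply (continuity_2d_pt_of_continuous (fun w => fst (G w))), ccont_fst, HG; assumption. }
  destruct (uniform_continuity_2d (fun u v => snd (G (u, v))) a b 0 (2 * PI)) with (eps := mkposreal e' He')
    as [d2 H2].
  { intros x y Hx Hy. apply (continuity_2d_pt_of_continuous (fun w => snd (G w))), ccont_snd, HG; assumption. }
  exists (Rmin d1 d2). split; [apply Rmin_pos; apply cond_pos|].
  intros x x' Hx Hx' Hd. unfold vint.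
  pose proof (ccont_on_vertical _ _ _ _ _ _ HG Hx) as Cx.
  pose proof (ccont_on_vertical _ _ _ _ _ _ HG Hx') as Cx'.
  rewrite <- Cint_minus by (try assumption; lra).
  eapply Rle_trans; [apply Cint_bound with (M := 2 * e')|].
  - lra.
  - intros t Ht. apply ccont_minus; [apply Cx', Ht|apply Cx, Ht].
  - intros t Ht. eapply Rle_trans; [apply Cmod_le_abs|]. unfold Cminus, Cplus, Copp; cbn [fst snd].
    assert (Rabs (t - t) < d1 /\ Rabs (t - t) < d2) as [T1 T2].
    { replace (t - t) with 0 by ring. rewrite Rabs_R0. split; apply cond_pos. }
    pose proof (H1 x t x' t Hx Ht Hx' Ht (Rlt_le_trans _ _ _ Hd (Rmin_l _ _)) T1) as K1.
    pose proof (H2 x t x' t Hx Ht Hx' Ht (Rlt_le_trans _ _ _ Hd (Rmin_r _ _)) T2) as K2.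
    cbn [pos] in K1, K2. unfold Rminus in K1, K2. lra.
  - right. unfold e'. field. generalize PI_RGT_0; lra.
Qed.

Lemma vint_const_holo (G : C -> C) (a b : R) : a <= b ->
  (forall t, G (t, 2 * PI) = G (t, 0)) ->
  (forall x y, a <= x <= b -> 0 <= y <= 2 * PI -> cdiff G (x, y)) -> vint G a = vint G b.
Proof.
  intros Hab Hper HG. pose proof two_PI_pos as Hpi.
  assert (E := goursat_rect G a b 0 (2 * PI) Hab (Rlt_le _ _ Hpi) HG).
  unfold rect_int in E. fold (vint G a) (vint G b) in E.
  rewrite (Cint_ext (fun t => G (t, 2 * PI)) (fun t => G (t, 0))) in E by (intros; first [apply Hper|exact Hab]).
  symmetry; apply (proj2 (Ceq_minus _ _)).
  replace (Cminus (vint G b) (vint G a))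
    with (Cmult (Copp Ci) (Cplus (Cminus (Cint (fun t => G (t, 0)) a b) (Cint (fun t => G (t, 0)) a b))
       (Cmult Ci (Cminus (vint G b) (vint G a))))).
  - rewrite E. ring.
  - transitivity (Cmult (Copp (Cmult Ci Ci)) (Cminus (vint G b) (vint G a))); [ring|].
    replace (Cmult Ci Ci) with (Copp 1) by (unfold Cmult, Copp, Ci, RtoC; cbn [fst snd]; apply (f_equal2 pair); ring).
    ring.
Qed.

(** On the exceptional line [x = s] continuity suffices: the holomorphic case reaches every abscissa
    short of [s] from either side, and uniform continuity closes the gap. This is what the
    difference quotient requires, whose one doubtful point lies on such a line. *)
Lemma vint_const (G : C -> C) (a b s : R) : a <= b ->
  (forall t, G (t, 2 * PI) = G (t, 0)) -> ccont_rect G a b 0 (2 * PI) ->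
  (forall x y, a <= x <= b -> 0 <= y <= 2 * PI -> x <> s -> cdiff G (x, y)) -> vint G a = vint G b.
Proof.
  intros Hab Hper Hc HG. pose proof two_PI_pos as Hpi.
  destruct (Rlt_dec s a) as [L|L]; [apply vint_const_holo; [assumption..|]; intros; apply HG; lra|].
  destruct (Rlt_dec b s) as [L'|L']; [apply vint_const_holo; [assumption..|]; intros; apply HG; lra|].
  transitivity (vint G s).
  - apply (proj2 (Ceq_minus _ _)), Cmod_le_eps_0. intros e He.
    destruct (vint_unif_cont G a b Hc e He) as [d [Hd H]].
    destruct (Req_dec a s) as [->|N].
    + replace (Cminus (vint G s) (vint G s)) with (RtoC 0) by ring. rewrite Cmod_0; lra.
    (* A point strictly left of [s], still in the interval and within [d / 2] of [s]. *)
    + set (x := Rmax a (s - d / 2)).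
      assert (Hx : a <= x < s /\ s - d / 2 <= x)
        by (unfold x; split; [split; [apply Rmax_l|apply Rmax_lub_lt; lra]|apply Rmax_r]).
      rewrite (vint_const_holo G a x); [|lra|exact Hper|intros; apply HG; lra].
      apply H; [lra|lra|]. rewrite Rabs_left; lra.
  - apply (proj2 (Ceq_minus _ _)), Cmod_le_eps_0. intros e He.
    destruct (vint_unif_cont G a b Hc e He) as [d [Hd H]].
    destruct (Req_dec b s) as [->|N].
    + replace (Cminus (vint G s) (vint G s)) with (RtoC 0) by ring. rewrite Cmod_0; lra.
    + set (x := Rmin b (s + d / 2)).
      assert (Hx : s < x <= b /\ x <= s + d / 2)
        by (unfold x; split; [split; [apply Rmin_glb_lt; lra|apply Rmin_l]|apply Rmin_r]).
      rewrite <- (vint_const_holo G x b); [|lra|exact Hper|intros; apply HG; lra].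
      apply H; [lra|lra|]. rewrite Rabs_left; lra.
Qed.

(** * The complex exponential *)

Definition cexp (w : C) : C := (exp (fst w) * cos (snd w), exp (fst w) * sin (snd w)).

Lemma cexp_plus (u v : C) : cexp (Cplus u v) = Cmult (cexp u) (cexp v).
Proof.
  unfold cexp, Cplus, Cmult; cbn [fst snd]. rewrite exp_plus, cos_plus, sin_plus.
  apply (f_equal2 pair); ring.
Qed.

Lemma Cmod_cexp (w : C) : Cmod (cexp w) = exp (fst w).
Proof.
  unfold Cmod, cexp; cbn [fst snd].
  replace ((exp (fst w) * cos (snd w)) ^ 2 + (exp (fst w) * sin (snd w)) ^ 2)
    with (Rsqr (exp (fst w)) * (Rsqr (sin (snd w)) + Rsqr (cos (snd w)))) by (unfold Rsqr; ring).
  rewrite sin2_cos2, Rmult_1_r, sqrt_Rsqr; [reflexivity|apply Rlt_le, exp_pos].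
Qed.

Lemma cexp_2PI (x : R) : cexp (x, 2 * PI) = cexp (x, 0).
Proof. unfold cexp; cbn [fst snd]. rewrite sin_2PI, cos_2PI, sin_0, cos_0. reflexivity. Qed.

Lemma derivable_pt_lim_approx (f : R -> R) (l : R) : derivable_pt_lim f 0 l ->
  forall e, 0 < e -> exists d, 0 < d /\ forall h, Rabs h < d -> Rabs (f h - f 0 - l * h) <= e * Rabs h.
Proof.
  intros H e He. destruct (H e He) as [d Hd]. exists d. split; [apply cond_pos|].
  intros h Hh. destruct (Req_dec h 0) as [->|N].
  - replace (f 0 - f 0 - l * 0) with 0 by ring. rewrite Rabs_R0. lra.
  - specialize (Hd h N Hh). rewrite Rplus_0_l in Hd.
    replace (f h - f 0 - l * h) with (((f h - f 0) / h - l) * h) by (field; exact N).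
    rewrite Rabs_mult. apply Rmult_le_compat_r; [apply Rabs_pos|lra].
Qed.

Lemma Cminus_0_r (z : C) : Cminus z 0 = z.
Proof. ring. Qed.

Lemma cdiff_cexp_0 : cdiff cexp 0.
Proof.
  apply cdiff_of_approx with (l := RtoC 1). intros e0 He0.
  (* [9 = 4 + 5] adds the error constants of the real part ([A1]) and the imaginary part ([A2]). The
     cap 1 gives [|x| < 1], hence [exp x <= 3]. *)
  set (e := Rmin 1 (e0 / 9)).
  assert (He : 0 < e) by (apply Rmin_pos; lra).
  assert (He1 : e <= 1) by apply Rmin_l. assert (He9 : 9 * e <= e0) by (generalize (Rmin_r 1 (e0 / 9)); fold e; lra).
  clearbody e.
  destruct (derivable_pt_lim_approx exp 1) with (e := e) as [d1 [Hd1 H1]];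
    [rewrite <- exp_0; apply derivable_pt_lim_exp|exact He|].
  destruct (derivable_pt_lim_approx cos 0) with (e := e) as [d2 [Hd2 H2]];
    [replace 0 with (- sin 0) at 2 by (rewrite sin_0; ring); apply derivable_pt_lim_cos|exact He|].
  destruct (derivable_pt_lim_approx sin 1) with (e := e) as [d3 [Hd3 H3]];
    [rewrite <- cos_0; apply derivable_pt_lim_sin|exact He|].
  exists (Rmin e (Rmin d1 (Rmin d2 d3))). split; [repeat apply Rmin_pos; assumption|].
  intros [x y] Hw.
  rewrite Cminus_0_r in *.
  assert (Hx := re_le_Cmod (x, y)). cbn [Re fst] in Hx.
  assert (Hy : Rabs y <= Cmod (x, y)) by (eapply Rle_trans; [|apply Rmax_Cmod]; apply Rmax_r).
  set (m := Cmod (x, y)) in *.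
  assert (m < e /\ m < d1 /\ m < d2 /\ m < d3) as (M0 & M1 & M2 & M3).
  { generalize (Rmin_l e (Rmin d1 (Rmin d2 d3))) (Rmin_r e (Rmin d1 (Rmin d2 d3)))
      (Rmin_l d1 (Rmin d2 d3)) (Rmin_r d1 (Rmin d2 d3)) (Rmin_l d2 d3) (Rmin_r d2 d3). lra. }
  specialize (H1 x). specialize (H2 y). specialize (H3 y).
  rewrite exp_0 in H1. rewrite cos_0 in H2. rewrite sin_0 in H3.
  assert (K1 : Rabs (exp x - 1 - 1 * x) <= e * Rabs x) by (apply H1; lra).
  assert (K2 : Rabs (cos y - 1 - 0 * y) <= e * Rabs y) by (apply H2; lra).
  assert (K3 : Rabs (sin y - 0 - 1 * y) <= e * Rabs y) by (apply H3; lra).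
  eapply Rle_trans; [apply Cmod_le_abs|].
  unfold cexp, Cminus, Cplus, Copp, Cmult, RtoC; cbn [fst snd].
  rewrite exp_0, cos_0, sin_0.
  assert (Px := Rabs_pos x). assert (Py := Rabs_pos y).
  assert (E1 : Rabs (exp x - 1) <= 2 * Rabs x).
  { replace (exp x - 1) with ((exp x - 1 - 1 * x) + x) by ring.
    eapply Rle_trans; [apply Rabs_triang|]. nra. }
  assert (E3 : Rabs (exp x) <= 3).
  { replace (exp x) with ((exp x - 1) + 1) by ring.
    eapply Rle_trans; [apply Rabs_triang|]. rewrite Rabs_R1. lra. }
  assert (Pe := Rabs_pos (exp x)).
  assert (A1 : Rabs (exp x * cos y - 1 - x) <= 4 * e * m).
  { replace (exp x * cos y - 1 - x) with (exp x * (cos y - 1 - 0 * y) + (exp x - 1 - 1 * x)) by ring.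
    eapply Rle_trans; [apply Rabs_triang|]. rewrite Rabs_mult.
    assert (Rabs (exp x) * Rabs (cos y - 1 - 0 * y) <= 3 * (e * m)).
    { apply Rmult_le_compat; [apply Rabs_pos|apply Rabs_pos|lra|nra]. }
    nra. }
  assert (A2 : Rabs (exp x * sin y - y) <= 5 * e * m).
  { replace (exp x * sin y - y) with (exp x * (sin y - 0 - 1 * y) + (exp x - 1) * y) by ring.
    eapply Rle_trans; [apply Rabs_triang|]. rewrite !Rabs_mult.
    assert (Rabs (exp x) * Rabs (sin y - 0 - 1 * y) <= 3 * (e * m)).
    { apply Rmult_le_compat; [apply Rabs_pos|apply Rabs_pos|lra|nra]. }
    assert (Rabs (exp x - 1) * Rabs y <= (2 * e) * m).
    { apply Rmult_le_compat; [apply Rabs_pos|apply Rabs_pos|lra|lra]. }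
    nra. }
  replace (exp x * cos y + - (1 * 1) + - (1 * x - 0 * y)) with (exp x * cos y - 1 - x) by ring.
  replace (exp x * sin y + - (1 * 0) + - (1 * y + 0 * x)) with (exp x * sin y - y) by ring.
  assert (0 <= m) by apply Cmod_ge_0. nra.
Qed.

(** The functional equation [cexp w = cexp z * cexp (w - z)] carries differentiability from 0 to
    [z]. *)
Lemma cdiff_cexp (z : C) : cdiff cexp z.
Proof.
  apply (cdiff_ext_loc (fun w => Cmult (cexp z) (cexp (Cminus w z)))).
  - apply (filter_forall (T := C)). intros w. rewrite <- cexp_plus. f_equal. ring.
  - apply cdiff_mult; [apply cdiff_const|]. apply cdiff_comp.
    + apply cdiff_minus; [apply cdiff_id|apply cdiff_const].
    + replace (Cminus z z) with (RtoC 0) by ring. apply cdiff_cexp_0.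
Qed.

(** [Q] is the difference quotient of [f] at [z], completed at [z] by the value of the continuous
    slope. Differentiability at [z] itself would be the removable singularity theorem and is not
    claimed. *)
Lemma slope_exists (f : C -> C) (rho : R) (z : C) :
  (forall w, Cmod w < rho -> cdiff f w) -> Cmod z < rho ->
  exists Q : C -> C, (forall w, f w = Cplus (f z) (Cmult (Q w) (Cminus w z))) /\
    (forall w, Cmod w < rho -> ccont Q w) /\ (forall w, Cmod w < rho -> w <> z -> cdiff Q w).
Proof.
  intros Hf Hz. destruct (Hf z Hz) as [phi [Hphi HL]].
  set (Q := fun w => if Ceq_dec w z then phi z else Cdiv (Cminus (f w) (f z)) (Cminus w z)).
  assert (Hd : forall w, Cmod w < rho -> w <> z -> cdiff Q w).
  { intros w Hw N. apply (cdiff_ext_loc (fun w => Cmult (Cminus (f w) (f z)) (Cinv (Cminus w z)))).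
    - apply Cmod_locally. exists (Cmod (Cminus w z)). split.
      + apply Cmod_gt_0, Cminus_eq_contra, N.
      + intros v Hv. unfold Q. destruct (Ceq_dec v z) as [->|_]; [|reflexivity].
        replace (Cminus z w) with (Copp (Cminus w z)) in Hv by ring. rewrite Cmod_opp in Hv. lra.
    - apply cdiff_mult; [apply cdiff_minus; [apply Hf, Hw|apply cdiff_const]|].
      apply cdiff_inv; [apply cdiff_minus; [apply cdiff_id|apply cdiff_const]|].
      apply Cminus_eq_contra, N. }
  exists Q. split; [|split; [|exact Hd]].
  - intros w. unfold Q. destruct (Ceq_dec w z) as [->|N]; [ring|].
    field. apply Cminus_eq_contra, N.
  - intros w Hw. destruct (Ceq_dec w z) as [->|N]; [|apply cdiff_ccont, Hd; assumption].
    apply (continuous_ext_loc (U := C_UniformSpace) _ phi); [|exact Hphi].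
    change (nearC z (fun w => phi w = Q w)). revert HL. apply (filter_imp (T := C)). intros w E.
    unfold Q. destruct (Ceq_dec w z) as [->|N]; [reflexivity|].
    rewrite E. field. apply Cminus_eq_contra, N.
Qed.

(** [x] is the logarithm of the radius, [t] the angle. *)
Definition circle (x t : R) : C := cexp (x, t).

Lemma Cmod_circle x t : Cmod (circle x t) = exp x.
Proof. apply (Cmod_cexp (x, t)). Qed.

Lemma ccont_circle x t : ccont (circle x) t.
Proof. apply (ccont_vertical cexp), cdiff_ccont, cdiff_cexp. Qed.

Lemma circle_minus_neq x t z : Cmod z < exp x -> Cminus (circle x t) z <> 0.
Proof.
  intros Hz. apply Cminus_eq_contra. intros E. rewrite <- E, Cmod_circle in Hz. lra.
Qed.

Lemma Cmod_circle_minus x t z : exp x - Cmod z <= Cmod (Cminus (circle x t) z).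
Proof.
  rewrite <- (Cmod_circle x t).
  generalize (Cmod_triangle (Cminus (circle x t) z) z).
  replace (Cplus (Cminus (circle x t) z) z) with (circle x t) by ring. lra.
Qed.

(** The integral is independent of the radius by [vint_const]; on small circles [Q] stays bounded
    while the factor [circle x t] tends to 0. *)
Lemma slope_circle_int (Q : C -> C) (rho : R) (z : C) (x : R) :
  (forall w, Cmod w < rho -> ccont Q w) -> (forall w, Cmod w < rho -> w <> z -> cdiff Q w) ->
  exp x < rho ->
  Cint (fun t => Cmult (Q (circle x t)) (circle x t)) 0 (2 * PI) = 0.
Proof.
  intros Hc Hd Hx. pose proof two_PI_pos as Hpi.
  set (G := fun w => Cmult (Q (cexp w)) (cexp w)).
  change (vint G x = 0).
  assert (Hr : 0 < rho) by (generalize (exp_pos x); lra).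
  assert (H0 : ccont Q (RtoC 0)) by (apply Hc; rewrite Cmod_0; exact Hr).
  destruct (proj1 (ccont_iff Q 0) H0 1 Rlt_0_1) as [d [Hd0 HB]].
  set (B := Cmod (Q 0) + 1). assert (HBpos : 0 < B) by (unfold B; generalize (Cmod_ge_0 (Q 0)); lra).
  assert (GC : forall a b, b <= x -> ccont_rect G a b 0 (2 * PI)).
  { intros a b Hb u v Hu Hv. apply (ccont_mult C_UniformSpace (fun w => Q (cexp w)) cexp).
    - apply ccont_comp; [apply cdiff_ccont, cdiff_cexp|]. apply Hc. rewrite Cmod_cexp. cbn [fst].
      eapply Rle_lt_trans; [|exact Hx]. destruct (Req_dec u x) as [->|]; [lra|]. left. apply exp_increasing. lra.
    - apply cdiff_ccont, cdiff_cexp. }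
  apply Cmod_le_eps_0. intros e He.
  (* [d / 2] puts the circle where [|Q| <= B]; the other term makes the bound
     [2 * (B * eta * (2 * PI))] at most [e]. *)
  set (eta := Rmin (d / 2) (e / (2 * B * (2 * PI)))).
  assert (He0 : 0 < 2 * B * (2 * PI)) by (apply Rmult_lt_0_compat; lra).
  assert (Heta : 0 < eta) by (apply Rmin_pos; [lra|apply Rdiv_lt_0_compat; assumption]).
  set (x0 := Rmin x (ln eta)).
  assert (Hx0 : exp x0 <= eta).
  { rewrite <- (exp_ln eta Heta). destruct (Req_dec x0 (ln eta)) as [->|N]; [lra|].
    left. apply exp_increasing. generalize (Rmin_r x (ln eta)). fold x0. lra. }
  (* In the logarithmic coordinate every preimage of [z] lies on this line. For [z = 0] there is no
     preimage, and the default value of [ln] at 0 does no harm. *)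
  rewrite <- (vint_const G x0 x (ln (Cmod z))).
  - unfold vint. eapply Rle_trans; [apply Cint_bound with (M := B * eta)|].
    + lra.
    + apply (ccont_on_vertical G x0 x); [apply GC; lra|]. generalize (Rmin_l x (ln eta)); fold x0; lra.
    + intros t Ht. unfold G. rewrite Cmod_mult, Cmod_cexp. cbn [fst].
      apply Rmult_le_compat; [apply Cmod_ge_0|left; apply exp_pos| |exact Hx0].
      unfold B. replace (Q (cexp (x0, t))) with (Cplus (Q 0) (Cminus (Q (cexp (x0, t))) (Q 0))) by ring.
      eapply Rle_trans; [apply Cmod_triangle|]. apply Rplus_le_compat_l. left. apply HB.
      rewrite Cminus_0_r, Cmod_cexp; cbn [fst].
      generalize (Rmin_l (d / 2) (e / (2 * B * (2 * PI)))); fold eta. lra.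
    + assert (eta * (2 * B * (2 * PI)) <= e); [|lra].
      apply Rle_trans with (e / (2 * B * (2 * PI)) * (2 * B * (2 * PI))).
      * apply Rmult_le_compat_r; [lra|apply Rmin_r].
      * right. field. generalize PI_RGT_0. lra.
  - apply Rmin_l.
  - intros t. unfold G. rewrite cexp_2PI. reflexivity.
  - apply GC; lra.
  - intros u v Hu Hv N. apply (cdiff_mult (fun w => Q (cexp w)) cexp); [|apply cdiff_cexp].
    apply cdiff_comp; [apply cdiff_cexp|]. apply Hd.
    + rewrite Cmod_cexp. cbn [fst].
      eapply Rle_lt_trans; [|exact Hx]. destruct (Req_dec u x) as [->|]; [lra|]. left. apply exp_increasing. lra.
    + intros E. apply N. rewrite <- E, Cmod_cexp. cbn [fst]. symmetry. apply ln_exp.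
Qed.

(** Here the radius grows instead: [1 / (zeta - z)] is holomorphic outside the circle and tends to 0
    at infinity. *)
Lemma inv_circle_int (z : C) (x : R) : Cmod z < exp x ->
  Cint (fun t => Cinv (Cminus (circle x t) z)) 0 (2 * PI) = 0.
Proof.
  intros Hz. pose proof two_PI_pos as Hpi.
  set (G := fun w => Cinv (Cminus (cexp w) z)). change (vint G x = 0).
  assert (Hm : forall u, x <= u -> exp x <= exp u).
  { intros u [H| ->]; [left; apply exp_increasing, H|lra]. }
  assert (GD : forall u v, x <= u -> cdiff G (u, v)).
  { intros u v Hu. apply (cdiff_inv (fun w => Cminus (cexp w) z)).
    - apply cdiff_minus; [apply cdiff_cexp|apply cdiff_const].
    - apply (circle_minus_neq u v). specialize (Hm u Hu). lra. }
  apply Cmod_le_eps_0. intros e He.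
  (* At radius at least [|z| + K] the integrand is at most [/ K], and [2 * (2 * PI) / K = e]. *)
  set (K := 4 * PI / e). assert (HK : 0 < K) by (apply Rdiv_lt_0_compat; lra).
  set (x1 := Rmax x (ln (Cmod z + K))).
  assert (Hx1 : Cmod z + K <= exp x1).
  { rewrite <- (exp_ln (Cmod z + K)) by (generalize (Cmod_ge_0 z); lra).
    destruct (Req_dec x1 (ln (Cmod z + K))) as [->|N]; [lra|].
    left. apply exp_increasing. generalize (Rmax_r x (ln (Cmod z + K))). fold x1. lra. }
  assert (Hxx : x <= x1) by apply Rmax_l.
  rewrite (vint_const_holo G x x1).
  - unfold vint. eapply Rle_trans; [apply Cint_bound with (M := / K)|].
    + lra.
    + intros t Ht. apply ccont_vertical, cdiff_ccont, GD, Hxx.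
    + intros t Ht. unfold G. rewrite Cmod_inv by (apply (circle_minus_neq x1 t); lra).
      apply Rinv_le_contravar; [exact HK|]. generalize (Cmod_circle_minus x1 t z). unfold circle. lra.
    + right. unfold K. field. generalize PI_RGT_0; lra.
  - exact Hxx.
  - intros t. unfold G. rewrite cexp_2PI. reflexivity.
  - intros u v Hu Hv. apply GD. lra.
Qed.

(** With [f(zeta) = f(z) + Q(zeta) (zeta - z)] the integrand splits as [Q(zeta) zeta + f(z) + f(z) z
    / (zeta - z)]. The first and last terms integrate to 0 by the two preceding lemmas. *)
Lemma cauchy_formula (f : C -> C) (rho x : R) (z : C) :
  (forall w, Cmod w < rho -> cdiff f w) -> exp x < rho -> Cmod z < exp x ->
  Cint (fun t => Cmult (f (circle x t)) (Cmult (circle x t) (Cinv (Cminus (circle x t) z)))) 0 (2 * PI)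
  = Cmult (RtoC (2 * PI)) (f z).
Proof.
  intros Hf Hx Hz. pose proof two_PI_pos as Hpi.
  destruct (slope_exists f rho z Hf) as [Q [HQ [Hc Hd]]]; [lra|].
  assert (C0 : ccont_on (fun t => Cmult (Q (circle x t)) (circle x t)) 0 (2 * PI)).
  { intros t _. apply ccont_mult; [|apply ccont_circle]. apply ccont_comp; [apply ccont_circle|].
    apply Hc. rewrite Cmod_circle; exact Hx. }
  assert (C1 : ccont_on (fun t => Cinv (Cminus (circle x t) z)) 0 (2 * PI)).
  { intros t _. apply ccont_inv; [|apply circle_minus_neq, Hz].
    apply ccont_minus; [apply ccont_circle|apply ccont_const]. }
  assert (C2 : ccont_on (fun t => Cmult (Cmult (f z) z) (Cinv (Cminus (circle x t) z))) 0 (2 * PI)).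
  { intros t Ht. apply ccont_mult; [apply ccont_const|apply C1, Ht]. }
  assert (C3 : ccont_on (fun _ => f z) 0 (2 * PI)) by (intros t _; apply ccont_const).
  rewrite (Cint_ext _ (fun t => Cplus (Cmult (Q (circle x t)) (circle x t))
    (Cplus (f z) (Cmult (Cmult (f z) z) (Cinv (Cminus (circle x t) z)))))); [|lra|].
  - rewrite Cint_plus; [|lra|exact C0|intros t Ht; apply ccont_plus; [apply C3|apply C2]; exact Ht].
    rewrite Cint_plus by (first [lra | assumption]).
    rewrite Cint_scal by (first [lra | assumption]).
    rewrite (slope_circle_int Q rho z x), inv_circle_int, Cint_const by (first [assumption | lra]).
    rewrite Rminus_0_r. ring.
  - intros t _. rewrite (HQ (circle x t)). field. apply circle_minus_neq, Hz.
Qed.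

(** * Leading terms and the identity theorem *)

Lemma ccont_on_bounded (f : R -> C) (a b : R) : a <= b -> ccont_on f a b ->
  exists M, 0 <= M /\ forall t, a <= t <= b -> Cmod (f t) <= M.
Proof.
  intros Hab Hf.
  destruct (continuity_ab_maj (fun t => fst (f t) * fst (f t) + snd (f t) * snd (f t)) a b Hab) as [m [Hm _]].
  - intros t Ht. apply continuity_pt_filterlim.
    assert (H1 := ccont_fst _ _ _ (Hf t Ht)). assert (H2 := ccont_snd _ _ _ (Hf t Ht)).
    exact (continuous_plus (V := R_NormedModule) _ _ t
      (continuous_mult (K := R_AbsRing) _ _ t H1 H1) (continuous_mult (K := R_AbsRing) _ _ t H2 H2)).
  - set (H := fst (f m) * fst (f m) + snd (f m) * snd (f m)) in *.
    assert (H0 : 0 <= H) by (unfold H; nra).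
    (* [H] bounds [|f|^2], and [|f|^2 <= H] gives [|f| <= H + 1] without a square root. *)
    exists (H + 1). split; [lra|]. intros t Ht. specialize (Hm t Ht). cbv beta in Hm.
    assert (E : Cmod (f t) * Cmod (f t) = fst (f t) * fst (f t) + snd (f t) * snd (f t)).
    { unfold Cmod. rewrite sqrt_sqrt; [ring|nra]. }
    generalize (Cmod_ge_0 (f t)). nra.
Qed.

(** * Taylor remainders by the Cauchy kernel *)

(** For holomorphic [f] this is [2 * PI] times [f(z)] minus its Taylor polynomial of degree below
    [n], divided by [z^n]. At [z = 0] it is [2 * PI] times the [n]-th Taylor coefficient. *)
Definition taylor_rem (f : C -> C) (x : R) (n : nat) (z : C) : C :=
  Cint (fun t => Cmult (f (circle x t))
    (Cmult (Cpow (Cinv (circle x t)) n) (Cmult (circle x t) (Cinv (Cminus (circle x t) z))))) 0 (2 * PI).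

Lemma circle_neq_0 x t : circle x t <> 0.
Proof. apply Cmod_gt_0. rewrite Cmod_circle. apply exp_pos. Qed.

Lemma ccont_pow (U : UniformSpace) (f : U -> C) (n : nat) (x : U) :
  ccont f x -> ccont (fun t => Cpow (f t) n) x.
Proof.
  intros H. induction n as [|n IH]; [apply ccont_const|]. simpl. apply ccont_mult; assumption.
Qed.

Section TaylorRemainder.

Variables (f : C -> C) (x : R).
Hypothesis Hf : ccont_on (fun t => f (circle x t)) 0 (2 * PI).

Lemma ccont_taylor_integrand (n : nat) (z : C) : Cmod z < exp x ->
  ccont_on (fun t => Cmult (f (circle x t))
    (Cmult (Cpow (Cinv (circle x t)) n) (Cmult (circle x t) (Cinv (Cminus (circle x t) z))))) 0 (2 * PI).
Proof.
  intros Hz t Ht. apply ccont_mult; [apply Hf, Ht|].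
  apply ccont_mult; [apply ccont_pow, ccont_inv; [apply ccont_circle|apply circle_neq_0]|].
  apply ccont_mult; [apply ccont_circle|].
  apply ccont_inv; [|apply circle_minus_neq, Hz].
  apply ccont_minus; [apply ccont_circle|apply ccont_const].
Qed.

(** One step of the geometric series under the integral:
    [zeta / (zeta - z) = 1 + z / (zeta - z)]. *)
Lemma taylor_rem_S (n : nat) (z : C) : Cmod z < exp x ->
  taylor_rem f x n z = Cplus (taylor_rem f x n 0) (Cmult z (taylor_rem f x (S n) z)).
Proof.
  intros Hz. pose proof two_PI_pos as Hpi.
  assert (H0 : Cmod 0 < exp x) by (rewrite Cmod_0; apply exp_pos).
  unfold taylor_rem.
  rewrite <- Cint_scal by (first [lra | apply ccont_taylor_integrand; assumption]).
  rewrite <- Cint_plus.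
  - apply Cint_ext; [lra|]. intros t _. rewrite Cpow_S. field. repeat split.
    + apply circle_minus_neq, Hz.
    + apply circle_neq_0.
  - lra.
  - apply ccont_taylor_integrand, H0.
  - intros t Ht. apply ccont_mult; [apply ccont_const|]. apply ccont_taylor_integrand; assumption.
Qed.

(** [M] serves all [n] and [z] at once, which permits both a fixed-order error bound and the limit
    [n] to infinity. *)
Lemma taylor_rem_bound : exists M, 0 <= M /\ forall n z, Cmod z < exp x ->
  Cmod (taylor_rem f x n z) <= M * (/ exp x) ^ n / (exp x - Cmod z).
Proof.
  pose proof two_PI_pos as Hpi.
  destruct (ccont_on_bounded _ 0 (2 * PI) (Rlt_le _ _ Hpi) Hf) as [M [HM0 HM]].
  assert (Ex := exp_pos x).
  exists (2 * (2 * PI) * M * exp x). split; [apply Rmult_le_pos; [apply Rmult_le_pos|]; lra|].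
  intros n z Hz.
  eapply Rle_trans; [apply Cint_bound with (M := M * ((/ exp x) ^ n * (exp x * / (exp x - Cmod z))))|].
  - lra.
  - apply ccont_taylor_integrand, Hz.
  - intros t Ht. rewrite !Cmod_mult, Cmod_pow, Cmod_inv by apply circle_neq_0.
    rewrite Cmod_inv by apply circle_minus_neq, Hz. rewrite Cmod_circle.
    assert (P : 0 < / exp x) by apply Rinv_0_lt_compat, Ex.
    assert (Pn : 0 < (/ exp x) ^ n) by apply pow_lt, P.
    assert (D := Cmod_circle_minus x t z).
    assert (I : 0 <= / Cmod (Cminus (circle x t) z)) by (left; apply Rinv_0_lt_compat; lra).
    apply Rmult_le_compat; [apply Cmod_ge_0| |apply HM, Ht|].
    + repeat apply Rmult_le_pos; lra.
    + apply Rmult_le_compat_l; [lra|]. apply Rmult_le_compat_l; [lra|].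
      apply Rinv_le_contravar; lra.
  - right. rewrite Rminus_0_r. field. lra.
Qed.

Lemma taylor_rem_leading (p : nat) : (forall k, (k < p)%nat -> taylor_rem f x k 0 = 0) ->
  forall z, Cmod z < exp x -> taylor_rem f x 0 z = Cmult (Cpow z p) (taylor_rem f x p z).
Proof.
  intros H z Hz. induction p as [|p IH]; [simpl; ring|].
  rewrite IH by (intros; apply H; lia). rewrite (taylor_rem_S p z Hz), (H p) by lia.
  rewrite Cpow_S. ring.
Qed.

End TaylorRemainder.

(** The expansion [f(a + w) = A w^p + O(|w|^(p+1))]. [A] may be 0 here; where the exact order
    matters, [A <> 0] is required separately. *)
Definition has_order (f : C -> C) (a : C) (p : nat) (A : C) : Prop :=
  exists K s, 0 < s /\ forall w, Cmod w < s ->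
    Cmod (Cminus (f (Cplus a w)) (Cmult A (Cpow w p))) <= K * Cmod w ^ S p.

(** If some Taylor coefficient is nonzero, the least such index gives the leading term. If all
    vanish, [f(w)] equals [w^N] times the [N]-th remainder up to [2 * PI], which is of size
    [(|w| / r)^N] and tends to 0. *)
Lemma zero_or_has_order_0 (f : C -> C) (rho r : R) :
  (forall w, Cmod w < rho -> cdiff f w) -> 0 < r < rho ->
  (forall w, Cmod w < r -> f w = 0) \/ exists p A, A <> RtoC 0 /\ has_order f 0 p A.
Proof.
  intros Hf [Hr Hrho]. pose proof two_PI_pos as Hpi.
  set (x := ln r). assert (Ex : exp x = r) by apply exp_ln, Hr.
  assert (Hfc : ccont_on (fun t => f (circle x t)) 0 (2 * PI)).
  { intros t _. apply ccont_comp; [apply ccont_circle|]. apply cdiff_ccont, Hf. rewrite Cmod_circle; lra. }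
  assert (Hcf : forall z, Cmod z < r -> Cmult (RtoC (2 * PI)) (f z) = taylor_rem f x 0 z).
  { intros z Hz. rewrite <- (cauchy_formula f rho x z) by (first [exact Hf | lra]).
    apply Cint_ext; [lra|]. intros t _. simpl. ring. }
  assert (H2pi : RtoC (2 * PI) <> 0) by (intros E; apply RtoC_inj in E; lra).
  destruct (taylor_rem_bound f x Hfc) as [M [HM HB]]. rewrite Ex in HB.
  destruct (classic (exists n, taylor_rem f x n 0 <> 0)) as [Hn|Hn].
  - right.
    destruct (dec_inh_nat_subset_has_unique_least_element (fun n => taylor_rem f x n 0 <> 0)) as [p [[Hp Hmin] _]];
      [intros n; apply classic|exact Hn|].
    assert (Hlow : forall k, (k < p)%nat -> taylor_rem f x k 0 = 0).
    { intros k Hk. apply NNPP. intros N. specialize (Hmin k N). lia. }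
    exists p, (Cmult (Cinv (RtoC (2 * PI))) (taylor_rem f x p 0)). split.
    { apply Cmult_neq_0; [|exact Hp]. intros E. apply C1_nz.
      rewrite <- (Cinv_r _ H2pi), E. ring. }
    (* For [|w| < r / 2] the denominator [r - |w|] in the remainder bound is at least [r / 2]. *)
    exists (/ (2 * PI) * (M * (/ r) ^ S p / (r / 2))), (r / 2). split; [lra|].
    intros w Hw. rewrite Cplus_0_l.
    assert (Hwr : Cmod w < exp x) by lra.
    assert (E : Cminus (f w) (Cmult (Cmult (Cinv (RtoC (2 * PI))) (taylor_rem f x p 0)) (Cpow w p))
      = Cmult (Cinv (RtoC (2 * PI))) (Cmult (Cpow w (S p)) (taylor_rem f x (S p) w))).
    { replace (f w) with (Cmult (Cinv (RtoC (2 * PI))) (Cmult (RtoC (2 * PI)) (f w))) by (field; exact H2pi).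
      rewrite Hcf by lra. rewrite (taylor_rem_leading f x Hfc p Hlow w Hwr), (taylor_rem_S f x Hfc p w Hwr), Cpow_S.
      ring. }
    rewrite E, !Cmod_mult, Cmod_pow, Cmod_inv, Cmod_R, Rabs_pos_eq by (first [exact H2pi | lra]).
    replace (/ (2 * PI) * (M * (/ r) ^ S p / (r / 2)) * Cmod w ^ S p)
      with (/ (2 * PI) * (Cmod w ^ S p * (M * (/ r) ^ S p / (r / 2)))) by ring.
    apply Rmult_le_compat_l; [left; apply Rinv_0_lt_compat, Hpi|].
    apply Rmult_le_compat_l; [apply pow_le, Cmod_ge_0|].
    eapply Rle_trans; [apply HB; lra|]. apply Rmult_le_compat_l.
    + apply Rmult_le_pos; [exact HM|]. apply pow_le. left. apply Rinv_0_lt_compat, Hr.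
    + apply Rinv_le_contravar; lra.
  - left. intros w Hw.
    assert (Hz : forall n, taylor_rem f x n 0 = 0)
      by (intros n; apply NNPP; intros N; apply Hn; exists n; exact N).
    assert (K : taylor_rem f x 0 w = 0).
    { apply Cmod_le_eps_0. intros e He. set (D := M / (r - Cmod w) + 1).
      assert (HD : 0 < D).
      { unfold D. assert (0 <= M / (r - Cmod w)); [|lra].
        apply Rmult_le_pos; [exact HM|]. left. apply Rinv_0_lt_compat. lra. }
      assert (Hq : 0 <= Cmod w * / r < 1).
      { split; [apply Rmult_le_pos; [apply Cmod_ge_0|left; apply Rinv_0_lt_compat, Hr]|].
        apply Rmult_lt_reg_r with r; [exact Hr|]. rewrite Rmult_assoc, Rinv_l by lra. lra. }
      destruct (pow_lt_1_zero (Cmod w * / r)) with (y := e / D) as [N HN];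
        [rewrite Rabs_pos_eq; lra|apply Rdiv_lt_0_compat; assumption|].
      specialize (HN N (le_n N)). rewrite Rabs_pos_eq in HN by (apply pow_le; lra).
      rewrite (taylor_rem_leading f x Hfc N) by (first [intros; apply Hz | lra]).
      rewrite Cmod_mult, Cmod_pow.
      eapply Rle_trans; [apply Rmult_le_compat_l; [apply pow_le, Cmod_ge_0|apply HB; lra]|].
      replace (Cmod w ^ N * (M * (/ r) ^ N / (r - Cmod w)))
        with ((Cmod w * / r) ^ N * (M / (r - Cmod w))) by (rewrite Rpow_mult_distr; field; lra).
      apply Rle_trans with (e / D * D); [|right; field; lra].
      apply Rmult_le_compat; [apply pow_le; lra| |lra|unfold D; lra].
      apply Rmult_le_pos; [exact HM|]. left. apply Rinv_0_lt_compat. lra. }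
    rewrite <- (Hcf w Hw) in K.
    replace (f w) with (Cmult (Cinv (RtoC (2 * PI))) (Cmult (RtoC (2 * PI)) (f w))) by (field; exact H2pi).
    rewrite K. ring.
Qed.

Definition holo_disc (f : C -> C) : Prop := forall z, Cmod z < 1 -> cdiff f z.

Lemma zero_or_has_order (f : C -> C) (a : C) (r : R) :
  holo_disc f -> 0 < r < 1 - Cmod a ->
  (forall w, Cmod w < r -> f (Cplus a w) = 0) \/ exists p A, A <> RtoC 0 /\ has_order f a p A.
Proof.
  intros Hf Hr.
  destruct (zero_or_has_order_0 (fun w => f (Cplus a w)) (1 - Cmod a) r) as [H|[p [A [HA [K [s [Hs H]]]]]]].
  - intros w Hw. apply (cdiff_comp f (fun w => Cplus a w)).
    + apply cdiff_plus; [apply cdiff_const|apply cdiff_id].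
    + apply Hf. eapply Rle_lt_trans; [apply Cmod_triangle|lra].
  - exact Hr.
  - left. exact H.
  - right. exists p, A. split; [exact HA|]. exists K, s. split; [exact Hs|].
    intros w Hw. specialize (H w Hw). rewrite Cplus_0_l in H. exact H.
Qed.

(** * Leading terms along a ray *)

(** The expansion [h(t) = B t^p + O(t^(p+1))] as [t] decreases to 0. Since [t] is real, such
    expansions survive conjugation, so that [|f|^2 = f conj f] has one as well. *)
Definition ray_order (h : R -> C) (p : nat) (B : C) : Prop :=
  exists K s, 0 < s /\ forall t, 0 < t < s -> Cmod (Cminus (h t) (Cmult B (RtoC (t ^ p)))) <= K * t ^ S p.

Lemma has_order_ray (f : C -> C) (a u : C) (p : nat) (A : C) :
  has_order f a p A -> ray_order (fun t => f (Cplus a (Cmult (RtoC t) u))) p (Cmult A (Cpow u p)).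
Proof.
  intros [K [s [Hs H]]]. assert (Hu := Cmod_ge_0 u).
  exists (K * Cmod u ^ S p), (s / (Cmod u + 1)). split; [apply Rdiv_lt_0_compat; lra|].
  intros t [Ht Hts].
  assert (E : Cmod (Cmult (RtoC t) u) = t * Cmod u) by (rewrite Cmod_mult, Cmod_R, Rabs_pos_eq; lra).
  assert (L : t * (Cmod u + 1) < s).
  { apply Rlt_le_trans with (s / (Cmod u + 1) * (Cmod u + 1)); [apply Rmult_lt_compat_r; lra|].
    right; field; lra. }
  specialize (H (Cmult (RtoC t) u)). rewrite E, Cpow_mult_l, <- RtoC_pow, Rpow_mult_distr in H.
  replace (Cmult (Cmult A (Cpow u p)) (RtoC (t ^ p))) with (Cmult A (Cmult (RtoC (t ^ p)) (Cpow u p))) by ring.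
  eapply Rle_trans; [apply H; nra|]. right; ring.
Qed.

Lemma ray_order_eventually (h k : R -> C) (p : nat) (B : C) :
  (exists s, 0 < s /\ forall t, 0 < t < s -> h t = k t) -> ray_order h p B -> ray_order k p B.
Proof.
  intros [s [Hs E]] [K [s' [Hs' H]]]. exists K, (Rmin s s'). split; [apply Rmin_pos; assumption|].
  intros t Ht. rewrite <- E; [apply H|]; generalize (Rmin_l s s') (Rmin_r s s'); lra.
Qed.

Lemma ray_order_plus (h k : R -> C) (p : nat) (B D : C) :
  ray_order h p B -> ray_order k p D -> ray_order (fun t => Cplus (h t) (k t)) p (Cplus B D).
Proof.
  intros [K [s [Hs H]]] [K' [s' [Hs' H']]]. exists (K + K'), (Rmin s s').
  split; [apply Rmin_pos; assumption|]. intros t Ht.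
  generalize (Rmin_l s s') (Rmin_r s s'). intros L L'.
  replace (Cminus (Cplus (h t) (k t)) (Cmult (Cplus B D) (RtoC (t ^ p)))) with
    (Cplus (Cminus (h t) (Cmult B (RtoC (t ^ p)))) (Cminus (k t) (Cmult D (RtoC (t ^ p))))) by ring.
  eapply Rle_trans; [apply Cmod_triangle|]. rewrite Rmult_plus_distr_r.
  apply Rplus_le_compat; [apply H|apply H']; lra.
Qed.

Lemma ray_order_const (c : C) : ray_order (fun _ => c) 0 c.
Proof.
  exists 0, 1. split; [lra|]. intros t _. simpl.
  replace (Cminus c (Cmult c 1)) with (RtoC 0) by ring. rewrite Cmod_0. lra.
Qed.

Lemma ray_order_0 (p : nat) : ray_order (fun _ => RtoC 0) p 0.
Proof.
  exists 0, 1. split; [lra|]. intros t _. rewrite Cmult_0_l, Cminus_0_r, Cmod_0. lra.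
Qed.

Lemma ray_order_conj (h : R -> C) (p : nat) (B : C) :
  ray_order h p B -> ray_order (fun t => Cconj (h t)) p (Cconj B).
Proof.
  intros [K [s [Hs H]]]. exists K, s. split; [exact Hs|]. intros t Ht.
  replace (Cminus (Cconj (h t)) (Cmult (Cconj B) (RtoC (t ^ p))))
    with (Cconj (Cminus (h t) (Cmult B (RtoC (t ^ p))))); [rewrite Cmod_conj; apply H, Ht|].
  rewrite Cminus_conj, Cmult_conj. f_equal. f_equal.
  unfold Cconj, RtoC; cbn [fst snd]. apply (f_equal2 pair); ring.
Qed.

Lemma ray_order_bound (h : R -> C) (p : nat) (B : C) : ray_order h p B ->
  exists M s, 0 <= M /\ 0 < s /\ forall t, 0 < t < s -> Cmod (h t) <= M * t ^ p.
Proof.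
  (* [K] carries no sign condition, hence [Rabs K]; the restriction to [t < 1] absorbs [t^(p+1)]
     into [t^p]. *)
  intros [K [s [Hs H]]]. exists (Rabs K + Cmod B), (Rmin s 1).
  split; [generalize (Rabs_pos K) (Cmod_ge_0 B); lra|].
  split; [apply Rmin_pos; lra|]. intros t Ht.
  generalize (Rmin_l s 1) (Rmin_r s 1). intros L L'.
  assert (P : 0 < t ^ p) by (apply pow_lt; lra).
  replace (h t) with (Cplus (Cminus (h t) (Cmult B (RtoC (t ^ p)))) (Cmult B (RtoC (t ^ p)))) by ring.
  eapply Rle_trans; [apply Cmod_triangle|]. rewrite Cmod_mult, Cmod_R, Rabs_pos_eq by lra.
  rewrite Rmult_plus_distr_r. apply Rplus_le_compat_r.
  eapply Rle_trans; [apply H; lra|]. simpl.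
  assert (K * (t * t ^ p) <= Rabs K * (t * t ^ p)) by (apply Rmult_le_compat_r; [nra|apply Rle_abs]).
  assert (Rabs K * (t * t ^ p) <= Rabs K * t ^ p) by (apply Rmult_le_compat_l; [apply Rabs_pos|nra]).
  lra.
Qed.

Lemma ray_order_mult (h k : R -> C) (p q : nat) (B D : C) :
  ray_order h p B -> ray_order k q D -> ray_order (fun t => Cmult (h t) (k t)) (p + q) (Cmult B D).
Proof.
  intros Hh Hk. destruct (ray_order_bound k q D Hk) as [M [s0 [HM [Hs0 Hb]]]].
  destruct Hh as [K [s [Hs H]]], Hk as [K' [s' [Hs' H']]].
  exists (K * M + Cmod B * K'), (Rmin s0 (Rmin s s')). split; [repeat apply Rmin_pos; assumption|].
  intros t Ht. generalize (Rmin_l s0 (Rmin s s')) (Rmin_r s0 (Rmin s s')) (Rmin_l s s') (Rmin_r s s').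
  intros L1 L2 L3 L4.
  assert (P : 0 < t ^ p) by (apply pow_lt; lra). assert (Q : 0 < t ^ q) by (apply pow_lt; lra).
  replace (Cminus (Cmult (h t) (k t)) (Cmult (Cmult B D) (RtoC (t ^ (p + q))))) with
    (Cplus (Cmult (Cminus (h t) (Cmult B (RtoC (t ^ p)))) (k t))
           (Cmult (Cmult B (RtoC (t ^ p))) (Cminus (k t) (Cmult D (RtoC (t ^ q))))))
    by (rewrite pow_add, RtoC_mult; ring).
  eapply Rle_trans; [apply Cmod_triangle|]. rewrite !Cmod_mult, Cmod_R, (Rabs_pos_eq (t ^ p)) by lra.
  assert (A1 := H t ltac:(lra)). assert (A2 := H' t ltac:(lra)). assert (A3 := Hb t ltac:(lra)).
  assert (Cmod (Cminus (h t) (Cmult B (RtoC (t ^ p)))) * Cmod (k t) <= (K * t ^ S p) * (M * t ^ q))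
    by (apply Rmult_le_compat; first [apply Cmod_ge_0 | assumption]).
  assert (Cmod B * t ^ p * Cmod (Cminus (k t) (Cmult D (RtoC (t ^ q)))) <= Cmod B * t ^ p * (K' * t ^ S q)).
  { apply Rmult_le_compat_l; [apply Rmult_le_pos; [apply Cmod_ge_0|lra]|exact A2]. }
  replace ((K * M + Cmod B * K') * t ^ S (p + q))
    with ((K * t ^ S p) * (M * t ^ q) + Cmod B * t ^ p * (K' * t ^ S q)) by (simpl; rewrite pow_add; ring).
  lra.
Qed.

Lemma ray_order_scal (c : C) (h : R -> C) (p : nat) (B : C) :
  ray_order h p B -> ray_order (fun t => Cmult c (h t)) p (Cmult c B).
Proof. intros H. apply (ray_order_mult _ h 0 p c B (ray_order_const c) H). Qed.

(** Read at a lower exponent the coefficient is 0. Together with [ray_order_unique] this excludes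
    two different orders with nonzero coefficients. *)
Lemma ray_order_weaken (h : R -> C) (p q : nat) (B : C) :
  (p < q)%nat -> ray_order h q B -> ray_order h p 0.
Proof.
  intros Hpq H. destruct (ray_order_bound h q B H) as [M [s [HM [Hs Hb]]]].
  exists M, (Rmin s 1). split; [apply Rmin_pos; lra|]. intros t Ht.
  generalize (Rmin_l s 1) (Rmin_r s 1). intros L L'.
  rewrite Cmult_0_l, Cminus_0_r.
  eapply Rle_trans; [apply Hb; lra|]. apply Rmult_le_compat_l; [exact HM|].
  replace q with (S p + (q - S p))%nat by lia. rewrite pow_add.
  assert (P : 0 < t ^ S p) by (apply pow_lt; lra).
  assert (Q : 0 <= t ^ (q - S p) <= 1).
  { split; [apply pow_le; lra|]. rewrite <- (pow1 (q - S p)). apply pow_incr. lra. }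
  nra.
Qed.

(** Subtracting the expansions and dividing by [t^p] leaves [|B - D| <= (K + K') t] for all small
    [t]. *)
Lemma ray_order_unique (h : R -> C) (p : nat) (B D : C) :
  ray_order h p B -> ray_order h p D -> B = D.
Proof.
  intros [K [s [Hs H]]] [K' [s' [Hs' H']]].
  apply (proj2 (Ceq_minus _ _)), Cmod_le_eps_0. intros e He.
  set (L := Rabs (K + K') + 1). assert (HL : 0 < L) by (unfold L; generalize (Rabs_pos (K + K')); lra).
  set (t := Rmin (e / L) (Rmin s s' / 2)).
  assert (Hm : 0 < Rmin s s') by (apply Rmin_pos; assumption).
  assert (He' : 0 < e / L) by (apply Rdiv_lt_0_compat; assumption).
  assert (Ht : 0 < t) by (apply Rmin_pos; lra).
  assert (Hts : t <= Rmin s s' / 2) by apply Rmin_r.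
  assert (HtL : t <= e / L) by apply Rmin_l.
  generalize (Rmin_l s s') (Rmin_r s s'). intros L1 L2.
  assert (P : 0 < t ^ p) by (apply pow_lt; lra).
  assert (A1 := H t ltac:(lra)). assert (A2 := H' t ltac:(lra)).
  assert (E : Cmod (Cmult (Cminus B D) (RtoC (t ^ p))) <= (K + K') * t ^ S p).
  { replace (Cmult (Cminus B D) (RtoC (t ^ p))) with
      (Cplus (Copp (Cminus (h t) (Cmult B (RtoC (t ^ p))))) (Cminus (h t) (Cmult D (RtoC (t ^ p))))) by ring.
    eapply Rle_trans; [apply Cmod_triangle|]. rewrite Cmod_opp. lra. }
  rewrite Cmod_mult, Cmod_R, Rabs_pos_eq in E by lra. simpl in E. rewrite <- Rmult_assoc in E.
  apply Rmult_le_reg_r in E; [|exact P].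
  eapply Rle_trans; [exact E|].
  apply Rle_trans with (L * t).
  - apply Rmult_le_compat_r; [lra|]. unfold L. generalize (Rle_abs (K + K')). lra.
  - apply Rle_trans with (L * (e / L)); [apply Rmult_le_compat_l; lra|right; field; lra].
Qed.

(** * The identity theorem *)

(** A function that vanishes near [c] cannot have a nonzero leading term there, as the ray in
    direction 1 shows; only the alternative of vanishing on the full disc remains. *)
Lemma zero_spreads (f : C -> C) (c : C) (s r : R) : holo_disc f ->
  0 < s -> (forall w, Cmod w < s -> f (Cplus c w) = 0) -> 0 < r < 1 - Cmod c ->
  forall w, Cmod w < r -> f (Cplus c w) = 0.
Proof.
  intros Hf Hs Hz Hr. destruct (zero_or_has_order f c r Hf Hr) as [H|[p [A [HA H]]]]; [exact H|exfalso].
  apply HA. apply (has_order_ray f c 1) in H. rewrite Cpow_1_l, Cmult_1_r in H.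
  apply (ray_order_unique _ _ _ _ H).
  apply (ray_order_eventually (fun _ => RtoC 0)).
  - exists s. split; [exact Hs|]. intros t Ht. symmetry. apply Hz.
    rewrite Cmult_1_r, Cmod_R, Rabs_pos_eq; lra.
  - apply ray_order_0.
Qed.

(** [N + 1] equally spaced centres lead from [a] to [z], closer together than [d]. By convexity they
    stay in the disc of radius [M], so a disc of radius [d] about each fits into the unit disc. *)
Lemma identity_theorem (f : C -> C) (a : C) (s : R) : holo_disc f -> Cmod a < 1 ->
  0 < s -> (forall w, Cmod w < s -> f (Cplus a w) = 0) -> forall z, Cmod z < 1 -> f z = 0.
Proof.
  intros Hf Ha Hs H0 z Hz.
  set (M := Rmax (Cmod a) (Cmod z)). assert (HM : M < 1) by (apply Rmax_lub_lt; assumption).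
  assert (HMa : Cmod a <= M) by apply Rmax_l. assert (HMz : Cmod z <= M) by apply Rmax_r.
  set (d := (1 - M) / 2). assert (Hd : 0 < d) by (unfold d; lra).
  destruct (INR_unbounded (Cmod (Cminus z a) / d)) as [N HN].
  assert (HN0 : 0 < INR N).
  { eapply Rle_lt_trans; [|exact HN]. apply Rmult_le_pos; [apply Cmod_ge_0|left; apply Rinv_0_lt_compat, Hd]. }
  assert (Hstep : Cmod (Cminus z a) / INR N < d).
  { apply Rmult_lt_reg_r with (INR N); [exact HN0|]. unfold Rdiv. rewrite Rmult_assoc, Rinv_l by lra.
    apply Rmult_lt_reg_r with (/ d); [apply Rinv_0_lt_compat, Hd|].
    replace (d * INR N * / d) with (INR N) by (field; lra). unfold Rdiv in HN. lra. }
  set (c := fun k => Cplus a (Cmult (RtoC (INR k / INR N)) (Cminus z a))).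
  assert (Hc : forall k, (k <= N)%nat -> Cmod (c k) <= M).
  { intros k Hk. apply le_INR in Hk. set (l := INR k / INR N).
    assert (Hl : 0 <= l <= 1).
    { assert (Hk0 := pos_INR k). unfold l. split; [apply Rmult_le_pos; [lra|left; apply Rinv_0_lt_compat, HN0]|].
      apply Rmult_le_reg_r with (INR N); [exact HN0|]. unfold Rdiv. rewrite Rmult_assoc, Rinv_l; lra. }
    unfold c. fold l.
    replace (Cplus a (Cmult (RtoC l) (Cminus z a))) with (Cplus (Cmult (RtoC (1 - l)) a) (Cmult (RtoC l) z))
      by (rewrite RtoC_minus; ring).
    eapply Rle_trans; [apply Cmod_triangle|]. rewrite !Cmod_mult, !Cmod_R, !Rabs_pos_eq by lra. nra. }
  assert (K : forall k, (k <= N)%nat -> forall w, Cmod w < d -> f (Cplus (c k) w) = 0).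
  { intros k. induction k as [|k IH]; intros Hk.
    - assert (E : c O = a) by (unfold c; simpl; unfold Rdiv; rewrite Rmult_0_l; ring). rewrite E.
      apply (zero_spreads f a s d); try assumption. unfold d; lra.
    - assert (E : forall w, Cplus (c (S k)) w = Cplus (c k) (Cplus (Cmult (RtoC (/ INR N)) (Cminus z a)) w)).
      { intros w. unfold c. rewrite S_INR. unfold Rdiv.
        rewrite Rmult_plus_distr_r, Rmult_1_l, RtoC_plus. ring. }
      (* The disc of radius [d] about [c k] contains the disc about [c (S k)] whose radius is [d]
         minus the step length. *)
      apply (zero_spreads f (c (S k)) (d - Cmod (Cminus z a) / INR N) d); [assumption|lra| |].
      + intros w Hw. rewrite E. apply IH; [lia|].
        eapply Rle_lt_trans; [apply Cmod_triangle|].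
        rewrite Cmod_mult, Cmod_R, Rabs_pos_eq by (left; apply Rinv_0_lt_compat, HN0).
        unfold Rdiv in Hw. rewrite (Rmult_comm (/ INR N)). lra.
      + generalize (Hc (S k) Hk). unfold d. lra. }
  assert (E : Cplus (c N) 0 = z).
  { unfold c. replace (INR N / INR N) with 1 by (field; lra). ring. }
  rewrite <- E. apply K; [lia|]. rewrite Cmod_0. exact Hd.
Qed.

(** * Segments, directions and rational angles *)

Lemma Cmod_sqr_conj (z w : C) : Cmod z = Cmod w -> Cmult z (Cconj z) = Cmult w (Cconj w).
Proof. intros E. rewrite <- !Cmod2_conj, E. reflexivity. Qed.

Lemma Cmult_conj_neq_0 (z : C) : z <> 0 -> Cmult z (Cconj z) <> 0.
Proof.
  intros H E. apply H. rewrite <- Cmod2_conj in E. apply RtoC_inj in E.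
  apply Cmod_eq_0. generalize (Cmod_ge_0 z). nra.
Qed.

(** At an endpoint only one direction stays in the segment: forward is possible unless [t0 = 1], and
    then backward is. *)
Lemma segment_ray (a b z : C) : segment a b z -> exists u, (u = Cminus b a \/ u = Copp (Cminus b a)) /\
  exists tau, 0 < tau /\ forall t, 0 < t < tau -> segment a b (Cplus z (Cmult (RtoC t) u)).
Proof.
  intros [t0 [Ht0 ->]]. destruct (Rlt_dec t0 1) as [L|L].
  - exists (Cminus b a). split; [left; reflexivity|]. exists (1 - t0). split; [lra|].
    intros t Ht. exists (t0 + t). split; [lra|]. rewrite RtoC_plus. ring.
  - exists (Copp (Cminus b a)). split; [right; reflexivity|]. exists 1. split; [lra|].
    intros t Ht. exists (t0 - t). split; [lra|]. rewrite RtoC_minus. ring.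
Qed.

Lemma segment_in_disc (a b z : C) : in_disc a -> in_disc b -> segment a b z -> in_disc z.
Proof.
  unfold in_disc. intros Ha Hb [t [Ht ->]].
  replace (Cplus a (Cmult (RtoC t) (Cminus b a))) with (Cplus (Cmult (RtoC (1 - t)) a) (Cmult (RtoC t) b))
    by (rewrite RtoC_minus; ring).
  eapply Rle_lt_trans; [apply Cmod_triangle|]. rewrite !Cmod_mult, !Cmod_R, !Rabs_pos_eq by lra.
  generalize (Rmax_l (Cmod a) (Cmod b)) (Rmax_r (Cmod a) (Cmod b)) (Rmax_lub_lt _ _ _ Ha Hb). nra.
Qed.

Lemma Cpow_cexp (m theta : R) (n : nat) :
  Cpow (Cmult (RtoC m) (cexp (0, theta))) n = Cmult (RtoC (m ^ n)) (cexp (0, INR n * theta)).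
Proof.
  rewrite Cpow_mult_l, <- RtoC_pow. f_equal. induction n as [|n IH].
  - unfold cexp; cbn [fst snd]. simpl. rewrite Rmult_0_l, exp_0, cos_0, sin_0.
    unfold RtoC. apply (f_equal2 pair); ring.
  - rewrite Cpow_S, IH, <- cexp_plus. f_equal. rewrite S_INR. unfold Cplus; cbn [fst snd].
    apply (f_equal2 pair); ring.
Qed.

Definition Creal (z : C) : Prop := Im z = 0.

(** A change of sign multiplies the power by a sign and conjugation conjugates it, so realness
    survives the reflection of [v] into the first quadrant, where its argument is the unoriented
    angle. *)
Lemma Creal_pow_abs (v : C) (n : nat) : Creal (Cpow v n) ->
  Creal (Cpow (Rabs (Re v), Rabs (Im v)) n).
Proof.
  assert (Hopp : forall w, Creal (Cpow w n) -> Creal (Cpow (Copp w) n)).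
  { intros w H. replace (Copp w) with (Cmult (Copp 1) w) by ring. rewrite Cpow_mult_l.
    replace (Cpow (Copp 1) n) with (RtoC ((-1) ^ n)).
    - unfold Creal. rewrite im_scal_l, H. ring.
    - rewrite RtoC_pow. f_equal. unfold RtoC, Copp; cbn [fst snd]. apply (f_equal2 pair); ring. }
  assert (Hconj : forall w, Creal (Cpow w n) -> Creal (Cpow (Cconj w) n)).
  { intros w H. rewrite <- Cpow_conj. unfold Creal. rewrite im_conj, H. ring. }
  intros H. destruct v as [a b]; unfold Re, Im; cbn [fst snd].
  unfold Rabs. destruct (Rcase_abs a), (Rcase_abs b).
  - exact (Hopp _ H).
  - assert (E : ((- a, b) : C) = Copp (Cconj (a, b))); [|rewrite E; exact (Hopp _ (Hconj _ H))].
    unfold Copp, Cconj; cbn [fst snd]. apply (f_equal2 pair); ring.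
  - exact (Hconj _ H).
  - exact H.
Qed.

(** The vector [(|Re v|, |Im v|)] is [|v|] times [exp(i theta)]. If its [n]-th power is real, then
    [sin (n theta) = 0] and [n theta] is a multiple of [PI]. *)
Lemma angle_in_pi_Q (v : C) (n : nat) (theta : R) : v <> 0 -> (0 < n)%nat ->
  theta = acos (Rabs (Re v) / Cmod v) -> Creal (Cpow v n) -> in_pi_Q theta.
Proof.
  intros Hv Hn Ht Hreal. apply Creal_pow_abs in Hreal.
  set (m := Cmod v) in *. assert (Hm : 0 < m) by (apply Cmod_gt_0, Hv).
  set (x := Rabs (Re v)) in *. set (y := Rabs (Im v)) in *.
  assert (Hx : 0 <= x) by apply Rabs_pos. assert (Hy : 0 <= y) by apply Rabs_pos.
  assert (Hxy : m * m = x * x + y * y).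
  { unfold m, x, y. replace (Cmod v * Cmod v) with (Cmod v ^ 2) by ring. rewrite Cmod2_alt.
    rewrite <- (pow2_abs (Re v)), <- (pow2_abs (Im v)). ring. }
  assert (Hxm : 0 <= x / m <= 1).
  { split; [apply Rmult_le_pos; [exact Hx|left; apply Rinv_0_lt_compat, Hm]|].
    apply Rmult_le_reg_r with m; [exact Hm|]. unfold Rdiv. rewrite Rmult_assoc, Rinv_l by lra. nra. }
  assert (Ec : cos theta = x / m) by (rewrite Ht; apply cos_acos; lra).
  assert (Es : sin theta = y / m).
  { rewrite Ht, sin_acos by lra. unfold Rsqr. replace (1 - x / m * (x / m)) with (y / m * (y / m)).
    - apply sqrt_square. apply Rmult_le_pos; [exact Hy|left; apply Rinv_0_lt_compat, Hm].
    - replace (y / m * (y / m)) with ((m * m - x * x) / (m * m)); [field; lra|].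
      replace (m * m - x * x) with (y * y) by lra. field; lra. }
  assert (E : ((x, y) : C) = Cmult (RtoC m) (cexp (0, theta))).
  { unfold cexp, RtoC, Cmult; cbn [fst snd]. rewrite Ec, Es, exp_0. apply (f_equal2 pair); field; lra. }
  rewrite E, Cpow_cexp in Hreal. unfold Creal in Hreal. rewrite im_scal_l in Hreal.
  unfold cexp, Im in Hreal; cbn [fst snd] in Hreal. rewrite exp_0, Rmult_1_l in Hreal.
  assert (Hmn : m ^ n <> 0) by (apply pow_nonzero; lra).
  apply Rmult_integral in Hreal. destruct Hreal as [Hreal|Hreal]; [contradiction|].
  apply sin_eq_0_0 in Hreal. destruct Hreal as [k Hk].
  assert (HnR : 0 < INR n) by (apply lt_0_INR, Hn).
  exists k, (Z.of_nat n). split; [lia|]. rewrite <- INR_IZR_INZ.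
  apply Rmult_eq_reg_l with (INR n); [|lra]. rewrite Hk. field. lra.
Qed.

(** * Functions of equal modulus on a ray *)

Section Rays.

Variables (f g : C -> C) (z u : C) (tau : R).
Hypothesis Htau : 0 < tau.
Hypothesis Hmod : forall t, 0 < t < tau ->
  Cmod (f (Cplus z (Cmult (RtoC t) u))) = Cmod (g (Cplus z (Cmult (RtoC t) u))).

Let F t := f (Cplus z (Cmult (RtoC t) u)).
Let G t := g (Cplus z (Cmult (RtoC t) u)).

Lemma leading_terms_match (p q : nat) (A B : C) : A <> 0 -> B <> 0 -> u <> 0 ->
  has_order f z p A -> has_order g z q B -> p = q /\ Cmod A = Cmod B.
Proof.
  intros HA HB Hu Hf Hg.
  assert (Of := has_order_ray f z u p A Hf). assert (Og := has_order_ray g z u q B Hg).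
  assert (Of2 := ray_order_mult _ _ _ _ _ _ Of (ray_order_conj _ _ _ Of)).
  assert (Og2 := ray_order_mult _ _ _ _ _ _ Og (ray_order_conj _ _ _ Og)).
  assert (Of3 : ray_order (fun t => Cmult (G t) (Cconj (G t))) (p + p)
    (Cmult (Cmult A (Cpow u p)) (Cconj (Cmult A (Cpow u p))))).
  { revert Of2. apply ray_order_eventually. exists tau. split; [exact Htau|].
    intros t Ht. apply Cmod_sqr_conj, Hmod, Ht. }
  assert (NA : Cmult (Cmult A (Cpow u p)) (Cconj (Cmult A (Cpow u p))) <> 0).
  { apply Cmult_conj_neq_0, Cmult_neq_0; [exact HA|apply Cpow_nz, Hu]. }
  assert (NB : Cmult (Cmult B (Cpow u q)) (Cconj (Cmult B (Cpow u q))) <> 0).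
  { apply Cmult_conj_neq_0, Cmult_neq_0; [exact HB|apply Cpow_nz, Hu]. }
  (* [|f|^2] and [|g|^2] agree on the ray and have exact orders [2p] and [2q]; a strict inequality
     would force the coefficient of the lower order to be 0. *)
  assert (Epq : p = q).
  { destruct (Nat.lt_total p q) as [L|[E|L]]; [|exact E|]; exfalso.
    - apply NA, (ray_order_unique _ _ _ _ Of3). apply (ray_order_weaken _ (p + p) (q + q) _ ltac:(lia) Og2).
    - apply NB, (ray_order_unique _ _ _ _ Og2). apply (ray_order_weaken _ (q + q) (p + p) _ ltac:(lia) Of3). }
  split; [exact Epq|]. subst q.
  assert (E := ray_order_unique _ _ _ _ Of3 Og2).
  rewrite <- !Cmod2_conj in E. apply RtoC_inj in E. rewrite !Cmod_mult in E.
  assert (Hup : 0 < Cmod (Cpow u p)) by (apply Cmod_gt_0, Cpow_nz, Hu).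
  apply Rmult_eq_reg_r with (Cmod (Cpow u p)); [|lra].
  assert (H1 : 0 <= Cmod A * Cmod (Cpow u p)) by (apply Rmult_le_pos; [apply Cmod_ge_0|lra]).
  assert (H2 : 0 <= Cmod B * Cmod (Cpow u p)) by (apply Rmult_le_pos; [apply Cmod_ge_0|lra]).
  apply Rsqr_inj; [exact H1|exact H2|]. rewrite !Rsqr_pow2. exact E.
Qed.

(** Excludes the mixed case in which one function vanishes near [z] and the other does not: on the
    ray [|g| = |f| = 0]. *)
Lemma zero_leading_term (r : R) (q : nat) (B : C) : u <> 0 -> 0 < r ->
  (forall w, Cmod w < r -> f (Cplus z w) = 0) -> has_order g z q B -> B = 0.
Proof.
  intros Hu Hr Hz Hg. apply NNPP. intros HB.
  apply (Cmult_neq_0 B (Cpow u q) HB (Cpow_nz _ _ Hu)).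
  apply (ray_order_unique _ _ _ _ (has_order_ray g z u q B Hg)).
  apply (ray_order_eventually (fun _ => RtoC 0)); [|apply ray_order_0].
  assert (Hu0 := Cmod_ge_0 u).
  exists (Rmin tau (r / (Cmod u + 1))). split; [apply Rmin_pos; [exact Htau|apply Rdiv_lt_0_compat; lra]|].
  intros t [Ht Hts]. generalize (Rmin_l tau (r / (Cmod u + 1))) (Rmin_r tau (r / (Cmod u + 1))). intros L1 L2.
  symmetry. apply Cmod_eq_0. rewrite <- Hmod by lra. rewrite Hz; [apply Cmod_0|].
  rewrite Cmod_mult, Cmod_R, Rabs_pos_eq by lra.
  assert (L : t * (Cmod u + 1) < r); [|nra].
  apply Rlt_le_trans with (r / (Cmod u + 1) * (Cmod u + 1)); [apply Rmult_lt_compat_r; lra|].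
  right; field; lra.
Qed.

(* On the ray [0 = |f|^2 - |f - d|^2 = 2 Re (f conj d) - |d|^2], and [|d|^2] is of higher order. *)
Lemma perturbation_phase (p n : nat) (A D : C) : (0 < n)%nat -> u <> 0 ->
  has_order f z p A -> has_order (fun w => Cminus (f w) (g w)) z (p + n) D ->
  Cplus (Cmult (Cmult A (Cconj D)) (Cconj (Cpow u n))) (Cmult (Cmult (Cconj A) D) (Cpow u n)) = 0.
Proof.
  intros Hn Hu Hf Hd.
  assert (Of := has_order_ray f z u p A Hf). assert (Od := has_order_ray _ z u _ D Hd). cbv beta in Od.
  fold (F) in Of.
  set (d := fun t => Cminus (f (Cplus z (Cmult (RtoC t) u))) (g (Cplus z (Cmult (RtoC t) u)))) in *.
  assert (O1 := ray_order_mult _ _ _ _ _ _ Of (ray_order_conj _ _ _ Od)).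
  assert (O2 := ray_order_mult _ _ _ _ _ _ (ray_order_conj _ _ _ Of) Od).
  assert (O3 := ray_order_plus _ _ _ _ _ O1 O2).
  assert (O4 := ray_order_mult _ _ _ _ _ _ Od (ray_order_conj _ _ _ Od)).
  apply (ray_order_weaken _ (p + (p + n)) (p + n + (p + n)) _ ltac:(lia)) in O4.
  assert (E : forall t, 0 < t < tau -> Cmult (d t) (Cconj (d t)) =
    Cplus (Cmult (F t) (Cconj (d t))) (Cmult (Cconj (F t)) (d t))).
  { intros t Ht. assert (E := Cmod_sqr_conj _ _ (Hmod t Ht)). fold (F t) (G t) in E.
    change (d t) with (Cminus (F t) (G t)). rewrite Cminus_conj.
    replace (Cmult (Cminus (F t) (G t)) (Cminus (Cconj (F t)) (Cconj (G t)))) with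
      (Cplus (Cminus (Cmult (F t) (Cconj (F t))) (Cplus (Cmult (F t) (Cconj (G t))) (Cmult (G t) (Cconj (F t)))))
       (Cmult (G t) (Cconj (G t)))) by ring.
    rewrite <- E. ring. }
  assert (O5 : ray_order (fun t => Cplus (Cmult (F t) (Cconj (d t))) (Cmult (Cconj (F t)) (d t))) (p + (p + n)) 0).
  { revert O4. apply ray_order_eventually. exists tau. split; [exact Htau|exact E]. }
  assert (Z := ray_order_unique _ _ _ _ O3 O5).
  rewrite Cpow_add_r, !Cmult_conj in Z.
  (* Both terms of [Z] contain the factor [|u^p|^2], which is nonzero and can be cancelled. *)
  assert (Nu : Cmult (Cpow u p) (Cconj (Cpow u p)) <> 0) by (apply Cmult_conj_neq_0, Cpow_nz, Hu).
  set (W := Cplus _ _).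
  replace W with (Cmult (Cinv (Cmult (Cpow u p) (Cconj (Cpow u p))))
    (Cmult (Cmult (Cpow u p) (Cconj (Cpow u p))) W)) by (field; split; intros Q; apply Nu; rewrite Q; ring).
  replace (Cmult (Cmult (Cpow u p) (Cconj (Cpow u p))) W) with (RtoC 0); [ring|].
  rewrite <- Z. unfold W. ring.
Qed.

End Rays.

(** The hypotheses say [Re(E conj(u^n)) = 0] for [u = u1, u2], so both powers lie on the real line
    spanned by [i E], and the product of one with the conjugate of the other is real. *)
Lemma phases_real (E u1 u2 : C) (n : nat) : E <> 0 ->
  Cplus (Cmult E (Cconj (Cpow u1 n))) (Cmult (Cconj E) (Cpow u1 n)) = 0 ->
  Cplus (Cmult E (Cconj (Cpow u2 n))) (Cmult (Cconj E) (Cpow u2 n)) = 0 ->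
  Creal (Cpow (Cmult u1 (Cconj u2)) n).
Proof.
  intros HE H1 H2. rewrite Cpow_mult_l, <- Cpow_conj.
  set (U := Cpow u1 n) in *. set (V := Cpow u2 n) in *.
  assert (K : Cmult U (Cconj V) = Cconj (Cmult U (Cconj V))).
  { rewrite Cmult_conj, Cconj_conj. apply (proj2 (Ceq_minus _ _)).
    replace (Cminus (Cmult U (Cconj V)) (Cmult (Cconj U) V)) with
      (Cmult (Cinv E) (Cminus (Cmult U (Cplus (Cmult E (Cconj V)) (Cmult (Cconj E) V)))
         (Cmult V (Cplus (Cmult E (Cconj U)) (Cmult (Cconj E) U))))) by (field; exact HE).
    rewrite H1, H2. ring. }
  apply (f_equal Im) in K. rewrite im_conj in K. unfold Creal. lra.
Qed.

Theorem theorem2p1 (f g : C -> C) (a1 b1 a2 b2 : C) (theta : R) :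
  analytic_on_disc f -> analytic_on_disc g ->
  disc_segment a1 b1 -> disc_segment a2 b2 ->
  segments_intersect_at_angle a1 b1 a2 b2 theta ->
  0 < theta < PI / 2 -> ~ in_pi_Q theta ->
  (forall z : C, segment a1 b1 z \/ segment a2 b2 z -> Cmod (f z) = Cmod (g z)) ->
  exists beta : C, Cmod beta = 1 /\ forall z : C, in_disc z -> f z = Cmult beta (g z).
Proof.
  intros Hf Hg [N1 [Ha1 Hb1]] [N2 [Ha2 Hb2]] [[z [S1 S2]] Htheta] _ Hirr Hmod.
  assert (Df : holo_disc f) by (intros w Hw; apply cdiff_of_ex_derive, Hf, Hw).
  assert (Dg : holo_disc g) by (intros w Hw; apply cdiff_of_ex_derive, Hg, Hw).
  assert (Hz : Cmod z < 1) by exact (segment_in_disc _ _ _ Ha1 Hb1 S1).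
  destruct (segment_ray _ _ _ S1) as [u1 [Eu1 [t1 [Ht1 R1]]]].
  destruct (segment_ray _ _ _ S2) as [u2 [Eu2 [t2 [Ht2 R2]]]].
  assert (M1 : forall t, 0 < t < t1 -> Cmod (f (Cplus z (Cmult (RtoC t) u1))) = Cmod (g (Cplus z (Cmult (RtoC t) u1))))
    by (intros t Ht; apply Hmod; left; apply R1, Ht).
  assert (M2 : forall t, 0 < t < t2 -> Cmod (f (Cplus z (Cmult (RtoC t) u2))) = Cmod (g (Cplus z (Cmult (RtoC t) u2))))
    by (intros t Ht; apply Hmod; right; apply R2, Ht).
  assert (Hd1 : Cminus b1 a1 <> 0) by (apply Cminus_eq_contra; congruence).
  assert (Hd2 : Cminus b2 a2 <> 0) by (apply Cminus_eq_contra; congruence).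
  assert (Nopp : forall w : C, w <> 0 -> Copp w <> 0).
  { intros w Hw Q. apply Hw. replace w with (Copp (Copp w)) by ring. rewrite Q. ring. }
  assert (Hu1 : u1 <> 0) by (destruct Eu1 as [->| ->]; [|apply Nopp]; exact Hd1).
  assert (Hu2 : u2 <> 0) by (destruct Eu2 as [->| ->]; [|apply Nopp]; exact Hd2).
  (* Reversing a direction changes [u1 * conj u2] only by a sign, which the absolute value in
     [seg_angle] ignores. *)
  assert (Hang : theta = acos (Rabs (Re (Cmult u1 (Cconj u2))) / Cmod (Cmult u1 (Cconj u2)))).
  { rewrite Htheta. unfold seg_angle. rewrite Cmod_mult, Cmod_conj. f_equal.
    destruct Eu1 as [->| ->], Eu2 as [->| ->]; rewrite ?Cmod_opp, ?Copp_conj; f_equal;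
      set (x := Cminus b1 a1); set (y := Cconj (Cminus b2 a2)).
    - replace (Cmult x (Copp y)) with (Copp (Cmult x y)) by ring. rewrite re_opp, Rabs_Ropp. reflexivity.
    - replace (Cmult (Copp x) y) with (Copp (Cmult x y)) by ring. rewrite re_opp, Rabs_Ropp. reflexivity.
    - replace (Cmult (Copp x) (Copp y)) with (Cmult x y) by ring. reflexivity. }
  set (r := (1 - Cmod z) / 2). assert (Hr : 0 < r < 1 - Cmod z) by (unfold r; lra).
  destruct (zero_or_has_order f z r Df Hr) as [Zf|[p [A [HA Of]]]];
  destruct (zero_or_has_order g z r Dg Hr) as [Zg|[q [B [HB Og]]]].
  (* Both functions vanish on the whole disc here, so any unimodular constant would serve. *)
  - exists (RtoC 1). split; [apply Cmod_1|]. intros w Hw.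
    rewrite (identity_theorem f z r Df Hz (proj1 Hr) Zf w Hw), (identity_theorem g z r Dg Hz (proj1 Hr) Zg w Hw). ring.
  - exfalso. exact (HB (zero_leading_term f g z u1 t1 Ht1 M1 r q B Hu1 (proj1 Hr) Zf Og)).
  - exfalso. apply HA.
    apply (zero_leading_term g f z u1 t1 Ht1 (fun t Ht => eq_sym (M1 t Ht)) r p A Hu1 (proj1 Hr) Zg Of).
  - destruct (leading_terms_match f g z u1 t1 Ht1 M1 p q A B HA HB Hu1 Of Og) as [<- EAB].
    set (beta := Cdiv A B).
    assert (Hbeta : Cmod beta = 1).
    { unfold beta. rewrite Cmod_div by exact HB. rewrite EAB. field.
      intros Q. apply HB, Cmod_eq_0, Q. }
    exists beta. split; [exact Hbeta|].
    set (h := fun w => Cmult beta (g w)).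
    assert (Dh : holo_disc (fun w => Cminus (f w) (h w))).
    { intros w Hw. apply cdiff_minus; [apply Df, Hw|]. apply cdiff_mult; [apply cdiff_const|apply Dg, Hw]. }
    destruct (zero_or_has_order (fun w => Cminus (f w) (h w)) z r Dh Hr) as [Zd|[m [D [HD Od]]]].
    + intros w Hw. apply (proj2 (Ceq_minus _ _)).
      exact (identity_theorem (fun w => Cminus (f w) (h w)) z r Dh Hz (proj1 Hr) Zd w Hw).
    + exfalso.
      assert (M1' : forall t, 0 < t < t1 -> Cmod (f (Cplus z (Cmult (RtoC t) u1))) = Cmod (h (Cplus z (Cmult (RtoC t) u1))))
        by (intros t Ht; unfold h; rewrite Cmod_mult, Hbeta, Rmult_1_l; apply M1, Ht).
      assert (M2' : forall t, 0 < t < t2 -> Cmod (f (Cplus z (Cmult (RtoC t) u2))) = Cmod (h (Cplus z (Cmult (RtoC t) u2))))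
        by (intros t Ht; unfold h; rewrite Cmod_mult, Hbeta, Rmult_1_l; apply M2, Ht).
      (* By the choice of [beta] the terms of order [p] cancel in [f - h]. If [m <= p], its
         coefficient of order [m] on the ray would be 0, contrary to [D <> 0]. *)
      assert (Lpm : (p < m)%nat).
      { apply Nat.nle_gt. intros L.
        assert (Rf := has_order_ray f z u1 p A Of).
        assert (Rg := ray_order_scal (Copp beta) _ _ _ (has_order_ray g z u1 p B Og)).
        assert (Rd := has_order_ray _ z u1 m D Od).
        assert (Rfg := ray_order_plus _ _ _ _ _ Rf Rg). cbv beta in Rd, Rfg.
        assert (R0 : ray_order (fun t => Cminus (f (Cplus z (Cmult (RtoC t) u1))) (h (Cplus z (Cmult (RtoC t) u1)))) p 0).
        { replace (RtoC 0) with (Cplus (Cmult A (Cpow u1 p)) (Cmult (Copp beta) (Cmult B (Cpow u1 p))))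
            by (unfold beta; field; exact HB).
          revert Rfg. apply ray_order_eventually. exists 1. split; [lra|]. intros t _. unfold h. ring. }
        assert (Rm : ray_order (fun t => Cminus (f (Cplus z (Cmult (RtoC t) u1))) (h (Cplus z (Cmult (RtoC t) u1)))) m 0).
        { apply Nat.lt_eq_cases in L. destruct L as [L| ->]; [exact (ray_order_weaken _ _ _ _ L R0)|exact R0]. }
        apply (Cmult_neq_0 D (Cpow u1 m) HD (Cpow_nz _ _ Hu1)).
        exact (ray_order_unique _ _ _ _ Rd Rm). }
      set (n := (m - p)%nat). assert (Em : m = (p + n)%nat) by (unfold n; lia).
      assert (Hn : (0 < n)%nat) by (unfold n; lia). rewrite Em in Od.
      assert (P1 := perturbation_phase f h z u1 t1 Ht1 M1' p n A D Hn Hu1 Of Od).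
      assert (P2 := perturbation_phase f h z u2 t2 Ht2 M2' p n A D Hn Hu2 Of Od).
      apply Hirr, (angle_in_pi_Q (Cmult u1 (Cconj u2)) n theta).
      * apply Cmult_neq_0; [exact Hu1|]. intros Q. apply Hu2, Cmod_eq_0. rewrite <- Cmod_conj, Q. apply Cmod_0.
      * exact Hn.
      * exact Hang.
      (* With [E = A conj D] the two phase relations take the form
         [E conj(u^n) + conj(E) u^n = 0]. *)
      * assert (EE : Cconj (Cmult A (Cconj D)) = Cmult (Cconj A) D) by (rewrite Cmult_conj, Cconj_conj; reflexivity).
        rewrite <- EE in P1, P2.
        apply (phases_real (Cmult A (Cconj D)) u1 u2 n); try assumption.
        apply Cmult_neq_0; [exact HA|]. intros Q. apply HD, Cmod_eq_0. rewrite <- Cmod_conj, Q. apply Cmod_0.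
Qed.
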